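(* Let $0<\alpha<1$, $A=-\log(1-\alpha)$ and $\beta>0$. Let $\{X(t),t\ge 0\}$ be a Negative-Binomial process, i.e. a Lévy process with values in $\{0,1,2,\ldots\}$ and Bernstein function $$\psi_X(\lambda)=\log\left(\frac{1-\alpha e^{-\lambda}}{1-\alpha}\right),\quad \lambda\ge 0,\qquad \psi_X(\infty)=A .$$ Let $\{T_\beta(t),t\ge 0\}$ be a Gamma subordinator with Bernstein function $$\psi_T(\lambda)=\log(1+\beta\lambda),\quad \lambda\ge 0,\qquad \psi_T(\infty)=\infty .$$ Suppose the processes $X(t)$ and $T_\beta(t)$ are independent. Then for the subordinated process $Y(t)=X(T_\beta(t))$ the following hold. (1) The Bernstein function of $Y(t)$ is $$\psi_Y(\lambda)=\log\left(1+\beta\log\left(\frac{1-\alpha e^{-\lambda}}{1-\alpha}\right)\right),\quad\lambda\ge 0,\qquad \psi_Y(\infty)=\log(1+A\beta).$$ (2) The Lévy measure of $Y(t)$ is $$\Pi_Y(n)=\frac{\alpha^n}{n!}\sum_{k=1}^{n}|s(n,k)|\,(k-1)!\left(\frac{\beta}{1+A\beta}\right)^{k},\qquad n=1,2,\ldots .$$ (3) The transition probability is, for $n=0,1,2,\ldots$, $$P(Y(t)=n)=\frac{\alpha^n}{n!}\,\frac{1}{(1+A\beta)^{t}}\sum_{k=0}^{n}|s(n,k)|\,[t]_{k\uparrow}\left(\frac{\beta}{1+A\beta}\right)^{k},$$ or equivalently $$P(Y(t)=n)=\frac{\alpha^n}{n!}\,\frac{1}{(1+A\beta)^{t}}\sum_{k=0}^{n}t^{k}\,B_{n,k}(w_\bullet),$$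 where the sequence $w_\bullet=(w_1,w_2,\ldots)$ is defined by $$w_n=\sum_{k=1}^{n}|s(n,k)|\,|s(k,1)|\left(\frac{\beta}{1+A\beta}\right)^{k},\qquad |s(k,1)|=(k-1)!.$$
   Context: A Lévy process here has stationary independent increments and starts at $0$; a subordinator is a Lévy process with nonnegative increments. The Bernstein function (Laplace exponent) $\psi_V$ of a Lévy process $V$ with values in $[0,\infty)$ is defined by $E[e^{-\lambda V(t)}]=\exp(-t\psi_V(\lambda))$, $\lambda\ge 0$, and $\psi_V(\infty)=\lim_{\lambda\to\infty}\psi_V(\lambda)$. For a Lévy process $V$ with values in $\{0,1,2,\ldots\}$ the Lévy measure is the sequence $\Pi_V(n)\ge 0$, $n=1,2,\ldots$, such that $\psi_V(\lambda)=\sum_{n\ge1}(1-e^{-\lambda n})\Pi_V(n)$ for all $\lambda\ge 0$. Rising factorial: $[t]_{k\uparrow}=t(t+1)\cdots(t+k-1)$, $[t]_{0\uparrow}=1$. Unsigned Stirling numbers of the first kind: $|s(n,k)|$ are defined by $[x]_{n\uparrow}=\sum_{k=0}^n|s(n,k)|x^k$. Partial Bell polynomials: for a sequence $x_\bullet=(x_1,x_2,\ldots)$ and $1\le k\le n$, $$B_{n,k}(x_\bullet)=\sum \frac{n!\,x_1^{k_1}\cdots x_n^{k_n}}{k_1!(1!)^{k_1}\cdots k_n!(n!)^{k_n}},$$ the sum running over all nonnegative integer solutions $(k_1,\ldots,k_n)$ of $k_1+2k_2+\cdots+nk_n=n$, $k_1+\cdots+k_n=k$. Conventions: $B_{0,0}=1$,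 and $B_{n,0}=B_{0,k}=0$ for $n,k>0$. *)

(* Defs.v *)
From HB Require Import structures.
From mathcomp Require Import all_boot all_order all_algebra archimedean.
From mathcomp Require Import all_classical all_reals all_analysis.
Set Implicit Arguments.
Unset Strict Implicit.
Unset Printing Implicit Defensive.
Import Order.TTheory GRing.Theory Num.Theory.
Import numFieldNormedType.Exports.
Local Open Scope classical_set_scope.
Local Open Scope ring_scope.

Definition rising (S : pzSemiRingType) (x : S) (k : nat) : S :=
  \prod_(i < k) (x + (i : nat)%:R).

(* |s(n, k)|: the coefficient of x^k in x (x + 1) ... (x + n - 1). *)
Definition stirling1 (n k : nat) : nat := ((rising ('X : {poly nat}) n)`_k)%R.

(* The index i : 'I_n stands for i + 1 in the usual notation: [m i] is k_{i+1}
   and the variable attached to it is [x i.+1] (the value [x 0] is not used).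
   Every solution of k_1 + 2 k_2 + ... + n k_n = n has all k_j <= n, hence the
   codomain 'I_n.+1.  For n = 0 the only index is the empty function, so that
   B_{0,0} = 1 and B_{n,0} = B_{0,k} = 0 for n, k > 0. *)
Definition bell (R : realType) (x : nat -> R) (n k : nat) : R :=
  \sum_(m : {ffun 'I_n -> 'I_n.+1} |
          (\sum_(i < n) i.+1 * m i == n)%N && (\sum_(i < n) m i == k)%N)
    n`!%:R * (\prod_(i < n) x i.+1 ^+ m i)
    / (\prod_(i < n) ((m i)`! * i.+1`! ^ m i)%N)%:R.

Section processes.
Context d (Omega : measurableType d) (R : realType) (P : probability Omega R).

(* A process (V(t), t >= 0) is a function on R of which only the values at
   nonnegative times matter. *)
Implicit Types (V W : R -> Omega -> R) (psi : R -> R).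

(* Path properties hold for every sample point (not only almost surely), so
   that the composition of one process with another is again measurable. *)
Record levy_process V : Prop := LevyProcess {
  levy_measurable : forall t : R, 0 <= t -> measurable_fun [set: Omega] (V t) ;
  levy_start : forall w, V 0 w = 0 ;
  levy_independent_increments : forall (n : nat) (t : nat -> R)
      (B : nat -> set R),
    0 <= t 0%N -> (forall i, t i <= t i.+1) -> (forall i, measurable (B i)) ->
    P (\bigcap_(i < n) [set w | B i (V (t i.+1) w - V (t i) w)]) =
    (\prod_(i < n) P [set w | B i (V (t i.+1) w - V (t i) w)%R])%E ;
  levy_stationary_increments : forall (s t : R) (B : set R),
    0 <= s -> 0 <= t -> measurable B ->
    P [set w | B (V (s + t) w - V s w)] = P [set w | B (V t w)] ;
  levy_right_continuous : forall w (t : R), 0 <= t ->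
    V s w @[s --> t^'+] --> V t w ;
  levy_left_limits : forall w (t : R), 0 < t -> cvg (V s w @[s --> t^'-])
}.

Definition subordinator V : Prop :=
  levy_process V /\
  forall w (s t : R), 0 <= s -> s <= t -> 0 <= V t w - V s w.

Definition nat_valued V : Prop :=
  forall w (t : R), 0 <= t -> V t w \is a Num.nat.

(* [psi] is the Laplace exponent of the nonnegative Levy process [V]; it is
   determined on [0, +oo[ only. *)
Definition bernstein_function V psi : Prop :=
  [/\ levy_process V,
      forall w (t : R), 0 <= t -> 0 <= V t w &
      forall t lambda : R, 0 <= t -> 0 <= lambda ->
        'E_P[fun w => expR (- lambda * V t w)]%E
        = (expR (- t * psi lambda))%:E].

(* psi(oo) = l *)
Definition value_at_infty psi (l : \bar R) : Prop :=
  (psi x)%:E @[x --> +oo] --> l.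

(* [Pi n] is the mass at n for n >= 1; [Pi 0] is not used. *)
Definition levy_measure V (Pi : nat -> R) : Prop :=
  [/\ nat_valued V,
      forall n, (1 <= n)%N -> 0 <= Pi n &
      exists2 psi, bernstein_function V psi &
        forall lambda : R, 0 <= lambda ->
          (psi lambda)%:E =
          (\sum_(1 <= n <oo) ((1 - expR (- lambda * n%:R)) * Pi n)%:E)%E].

Definition process_sigma V : set_system Omega :=
  <<s [set A | exists (t : R) (B : set R),
                 [/\ 0 <= t, measurable B & A = V t @^-1` B]] >>.

Definition independent_processes V W : Prop :=
  forall A B, process_sigma V A -> process_sigma W B ->
    (P (A `&` B) = P A * P B)%E.

Definition subordinate V W : R -> Omega -> R := fun t w => V (W t w) w.

End processes.

(* Main.v *)
Require Import Defs.
From HB Require Import structures.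
From mathcomp Require Import all_boot all_order all_algebra archimedean.
From mathcomp Require Import all_classical all_reals all_analysis.
From mathcomp Require Import measurable_realfun ring lra.
Set Implicit Arguments.
Unset Strict Implicit.
Unset Printing Implicit Defensive.
Import Order.TTheory GRing.Theory Num.Theory.
Import numFieldNormedType.Exports.
Local Open Scope classical_set_scope.
Local Open Scope ring_scope.

(** The diagonal map from [Omega] into the product of two copies of [Omega],
    carrying the sigma-algebras of [X] and of [T], pushes [P] to the product of
    its restrictions, so Tonelli's theorem lets one integrate over the paths of
    [X] with the path of [T] fixed.  As [T] has nondecreasing paths, [Y] inherits
    the path properties of [X]; its increments given [T] are independent with
    laws depending on the increments of [T] only, hence [Y] is a Levy process and
    [E exp(- lambda Y(t)) = E exp(- psiX(lambda) T(t))].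

    With [z = exp(- lambda)] and [L(x) = - ln (1 - x)], this Laplace transform
    is [((1 + A beta) (1 - c L(alpha z)))^(-t)].  Since
    [L(x)^k / k! = \sum_n |s(n, k)| x^n / n!], which results from comparing the
    coefficients of [t^k] in two expansions of [(1 - x)^(-t) = exp(t L(x))], the
    binomial and logarithmic series give the power series of the generating
    function and of the exponent; everything is nonnegative, so that sums commute
    and coefficients are unique.

    Finally [q_n(t) = \sum_k |s(n, k)| [t]_k c^k] satisfies a recurrence in [n]
    relating [t] to [t + 1] and a binomial convolution identity, which combine to
    [q_(n+1)(t) = t \sum_i 'C(n, i) w_(i+1) q_(n-i)(t)].  The Bell sums obey the same
    recurrence: they are coefficients of a product of truncated exponentials. *)

(** * Stirling numbers and rising factorials *)

Lemma rising0 (S : pzSemiRingType) (x : S) : rising x 0 = 1.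
Proof. exact: big_ord0. Qed.

Lemma risingS (S : pzSemiRingType) (x : S) k :
  rising x k.+1 = rising x k * (x + k%:R).
Proof. exact: big_ord_recr. Qed.

Lemma risingSl (S : pzSemiRingType) (x : S) k :
  rising x k.+1 = x * rising (x + 1) k.
Proof.
rewrite /rising big_ord_recl /= addr0; congr (_ * _).
by apply: eq_bigr => i _; rewrite /bump /= natrD addrA.
Qed.

Lemma rising_ge0 (R : numDomainType) (x : R) k : 0 <= x -> 0 <= rising x k.
Proof. by move=> x0; apply: prodr_ge0 => i _; rewrite addr_ge0. Qed.

Lemma rising1 (R : pzSemiRingType) k : rising (1 : R) k = k`!%:R.
Proof.
elim: k => [|k IH]; first by rewrite rising0.
by rewrite risingS IH factS mulnC natrM nat1r.
Qed.

Lemma stirling1SS n k :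
  stirling1 n.+1 k.+1 = (stirling1 n k + n * stirling1 n k.+1)%N.
Proof.
rewrite /stirling1 risingS mulrDr coefD coefMX /= mulr_natr coefMn.
by rewrite -mulr_natl natn.
Qed.

Lemma stirling1S0 n : stirling1 n.+1 0 = (n * stirling1 n 0)%N.
Proof.
by rewrite /stirling1 risingS mulrDr coefD coefMX /= mulr_natr coefMn -mulr_natl natn add0r.
Qed.

Lemma stirling10 k : stirling1 0 k = (k == 0%N).
Proof. by rewrite /stirling1 rising0 coef1 natn. Qed.

Lemma stirling1_gt n k : (n < k)%N -> stirling1 n k = 0%N.
Proof.
elim: n k => [|n IH] [|k] // nk; first by rewrite stirling10.
by rewrite stirling1SS !IH ?muln0// ltnW.
Qed.

Lemma stirling1_n0 n : stirling1 n 0 = (n == 0%N).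
Proof.
elim: n => [|n IH]; first by rewrite stirling10.
by rewrite stirling1S0 IH; case: n {IH} => [|n]; rewrite ?muln0.
Qed.

Lemma stirling1_k1 k : stirling1 k.+1 1 = k`!.
Proof.
elim: k => [|k IH]; first by rewrite stirling1SS !stirling10.
by rewrite stirling1SS IH stirling1_n0 add0n factS.
Qed.

(** * Stirling transforms and binomial convolution *)

Section stirling_transform.
Context (R : comPzRingType) (c : R).
Implicit Types (u v : nat -> R) (s t : R).

(** If U is the exponential generating function of [u], the transform has U(c L(x)) with L(x) = - ln
    (1 - x). Keeping [u] arbitrary treats the transition probabilities and the Lévy measure
    together. *)
Definition stirling_transform u n : R :=
  \sum_(k < n.+1) (stirling1 n k)%:R * (u k * c ^+ k).

(** On generating functions this is (1 - x) F' = c U'(c L(x)), for F = U(c L(x)). *)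
Lemma stirling_transformS u n : stirling_transform u n.+1 =
  n%:R * stirling_transform u n + c * stirling_transform (fun k => u k.+1) n.
Proof.
rewrite /stirling_transform big_ord_recl /=.
under eq_bigr do rewrite stirling1SS natrD natrM mulrDl.
rewrite big_split /= addrCA addrC; congr (_ + _); last first.
  by rewrite mulr_sumr; apply: eq_bigr => k _; rewrite exprS; ring.
rewrite stirling1S0 natrM [RHS]mulr_sumr [RHS]big_ord_recl /= !mulrA; congr (_ + _).
rewrite big_ord_recr /= stirling1_gt// mulr0 !mul0r addr0.
by apply: eq_bigr => i _; rewrite !mulrA.
Qed.

(** Its exponential generating function is (1 - c L(x))^(-t). *)
Definition rising_transform t := stirling_transform (rising t).

Lemma eq_stirling_transform u v n :
  (forall k, u k = v k) -> stirling_transform u n = stirling_transform v n.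
Proof. by move=> uv; apply: eq_bigr => k _; rewrite uv. Qed.

Lemma stirling_transformZ s u n :
  stirling_transform (fun k => s * u k) n = s * stirling_transform u n.
Proof. by rewrite mulr_sumr; apply: eq_bigr => k _; ring. Qed.

Lemma rising_transformS t n : rising_transform t n.+1 =
  n%:R * rising_transform t n + c * t * rising_transform (t + 1) n.
Proof.
rewrite /rising_transform stirling_transformS -mulrA -(stirling_transformZ t).
rewrite (@eq_stirling_transform (fun k => rising t k.+1)
  (fun k => t * rising (t + 1) k))// => k.
by rewrite risingSl.
Qed.

Lemma rising_transform0 t : rising_transform t 0 = 1.
Proof.
by rewrite /rising_transform /stirling_transform big_ord1 stirling10 rising0 expr0 !mul1r.
Qed.

(** Product of exponential generating functions, read on coefficients. *)
Definition bconv u v n : R := \sum_(i < n.+1) 'C(n, i)%:R * (u i * v (n - i)%N).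

(* Leibniz rule: the shift of sequences is the derivative of exponential
   generating functions. *)
Lemma bconvS u v n :
  bconv u v n.+1 = bconv (fun i => u i.+1) v n + bconv u (fun i => v i.+1) n.
Proof.
rewrite /bconv big_ord_recl /=.
under eq_bigr => i _ do rewrite /= /bump /= add1n subSS binS natrD mulrDl.
rewrite big_split /= addrA [RHS]addrC; congr (_ + _).
rewrite big_ord_recr /= (bin_small (ltnSn n)) mul0r addr0 [RHS]big_ord_recl /= !bin0 !subn0.
congr (_ + _); apply: eq_bigr => i _ /=.
by rewrite /bump /= add1n subnSK.
Qed.

Lemma bconvDl u1 u2 v n :
  bconv (fun i => u1 i + u2 i) v n = bconv u1 v n + bconv u2 v n.
Proof. by rewrite -big_split /=; apply: eq_bigr => i _; ring. Qed.

Lemma bconvDr u v1 v2 n :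
  bconv u (fun i => v1 i + v2 i) n = bconv u v1 n + bconv u v2 n.
Proof. by rewrite -big_split /=; apply: eq_bigr => i _; ring. Qed.

Lemma bconvZl s u v n : bconv (fun i => s * u i) v n = s * bconv u v n.
Proof. by rewrite mulr_sumr; apply: eq_bigr => i _; ring. Qed.

Lemma bconvZr s u v n : bconv u (fun i => s * v i) n = s * bconv u v n.
Proof. by rewrite mulr_sumr; apply: eq_bigr => i _; ring. Qed.

Lemma eq_bconv u1 u2 v1 v2 n : u1 =1 u2 -> v1 =1 v2 ->
  bconv u1 v1 n = bconv u2 v2 n.
Proof. by move=> u12 v12; apply: eq_bigr => i _; rewrite u12 v12. Qed.

(** Multiplying the i-th coefficient by i is x d/dx, a derivation. *)
Lemma bconv_degree u v n :
  bconv (fun i => i%:R * u i) v n + bconv u (fun i => i%:R * v i) n =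
  n%:R * bconv u v n.
Proof.
rewrite -big_split /= mulr_sumr; apply: eq_bigr => i _ /=.
have -> : n%:R = i%:R + (n - i)%:R :> R by rewrite -natrD subnKC// -ltnS.
ring.
Qed.

Lemma bconv_degreel u v n :
  bconv (fun i => i%:R * u i) v n.+1 = n.+1%:R * bconv (fun i => u i.+1) v n.
Proof.
rewrite /bconv big_ord_recl /= mul0r mul0r mulr0 add0r mulr_sumr.
apply: eq_bigr => i _; rewrite /bump /= add1n subSS !mulrA; congr (_ * _ * _).
by rewrite -!natrM mulnC -mul_bin_diag mulnC.
Qed.

(** Coefficient form of the exponent law for (1 - c L(x))^(-t). The induction needs all [s] and [t]
    at once, since the recurrence in n raises one of them by 1. *)
Lemma rising_transformD s t n : rising_transform (s + t) n =
  bconv (rising_transform s) (rising_transform t) n.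
Proof.
elim: n s t => [|n IH] s t.
  by rewrite /bconv big_ord1 bin0 !rising_transform0 !mul1r.
rewrite bconvS (eq_bconv _ (rising_transformS s) (fun=> erefl)).
rewrite (eq_bconv _ (fun=> erefl) (rising_transformS t)).
rewrite bconvDl bconvDr addrACA bconv_degree bconvZl bconvZr -!IH rising_transformS.
by rewrite (addrAC s 1 t) (addrA s t 1); ring.
Qed.

Section log_transform.
Variable w : nat -> R.
Hypothesis wE : forall n, w n.+1 = stirling_transform (fun k => (stirling1 k 1)%:R) n.+1.

(** The shift of k |-> |s(k,1)| is k! = [1]_k, hence (1 - x) W' = c / (1 - c L(x)). *)
Lemma logS n : w n.+1 = n%:R * w n + c * rising_transform 1 n.
Proof.
rewrite wE stirling_transformS; congr (_ + c * _).
(* At n = 0 the factor n vanishes, so the arbitrary value [w 0] does no harm. *)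
- by case: n => [|n]; rewrite ?mul0r// wE.
- by apply: eq_stirling_transform => k; rewrite stirling1_k1 rising1.
Qed.

(* With [F(x) = \sum_n rising_transform t n x^n / n!] and [W] the exponential generating
   function of [w], this is [F' = t W' F]. *)
Lemma rising_transform_bconv t n : rising_transform t n.+1 =
  t * bconv (fun i => w i.+1) (rising_transform t) n.
Proof.
elim: n => [|n IH].
  rewrite rising_transformS /bconv big_ord1 bin0 logS !rising_transform0 !mul0r; ring.
(* Expanding W' by [logS] gives the two terms of [rising_transformS]: the part x W' F through the
   induction hypothesis, the other one through the convolution of the parameters 1 and t. *)
rewrite (eq_bconv _ logS (fun=> erefl)) bconvDl bconvZl -rising_transformD bconv_degreel.
rewrite rising_transformS IH (addrC 1 t); ring.
Qed.

End log_transform.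
End stirling_transform.

Lemma stirling_transform_ge0 (R : numDomainType) (c : R) (u : nat -> R) n :
  0 <= c -> (forall k, 0 <= u k) -> 0 <= stirling_transform c u n.
Proof.
by move=> c0 u0; apply: sumr_ge0 => k _; rewrite !mulr_ge0// exprn_ge0.
Qed.

(** * Bell polynomials *)

Section bell_generating_polynomial.
Context (R : realType) (a : nat -> R) (n : nat).

(** The series exp(a_i x^(i+1)) cut after j = n: the omitted terms have degree above n, and j ranges
    over the same set 'I_n.+1 as the multiplicities in [bell]. *)
Definition exp_trunc i : {poly R} :=
  \sum_(j < n.+1) (a i ^+ j / j`!%:R) *: 'X^(i.+1 * j).

Definition bell_poly : {poly R} := \prod_(i < n) exp_trunc i.

(** Derivative of the exponent \sum_(i < l) a_i x^(i+1) of the untruncated product. *)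
Definition bell_log_deriv l : {poly R} := \sum_(i < l) (i.+1%:R * a i) *: 'X^i.

(** Differentiation turns the term j + 1 into the term j times the derivative of a_i x^(i+1); only
    the last term j = n is left over, in degree i + (i + 1) n >= n. *)
Lemma exp_trunc_deriv i :
  'X^n %| (exp_trunc i)^`() - ((i.+1%:R * a i) *: 'X^i) * exp_trunc i.
Proof.
have stepE j : ((a i ^+ j.+1 / j.+1`!%:R) *: 'X^(i.+1 * j.+1) : {poly R})^`() =
    ((i.+1%:R * a i) *: 'X^i) * ((a i ^+ j / j`!%:R) *: 'X^(i.+1 * j)).
  rewrite derivZ derivXn mulnS addSn /= -scalerAr -scalerAl -exprD scalerA.
  rewrite -scalerMnr scalerMnl; congr (_ *: _).
  rewrite -mulr_natr -addSn -mulnS factS !natrM exprS.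
  by field; rewrite nat1r !pnatr_eq0 -!lt0n fact_gt0.
rewrite /exp_trunc raddf_sum big_ord_recl big_ord_recr /=.
rewrite muln0 expr0 derivZ derivC scaler0 add0r.
under eq_bigr do rewrite /bump /= stepE.
rewrite -mulr_sumr mulrDr opprD addrA subrr add0r dvdpNr.
by rewrite -scalerAr -scalerAl -exprD -!mul_polyC !dvdp_mull// dvdp_exp2l// mulSn addnCA leq_addr.
Qed.

Lemma bell_poly_deriv :
  'X^n %| bell_poly^`() - bell_log_deriv n * bell_poly.
Proof.
rewrite /bell_poly /bell_log_deriv.
(* Logarithmic derivatives add up: induction on the number l of factors, with the truncation order n
   fixed. *)
suff H l : 'X^n %| (\prod_(i < l) exp_trunc i)^`() -
    (\sum_(i < l) (i.+1%:R * a i) *: 'X^i) * \prod_(i < l) exp_trunc i.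
  exact: H.
elim: l => [|l IH].
  by rewrite !big_ord0 mul0r subr0 derivC dvdp0.
rewrite !big_ord_recr /= derivM.
set p := \prod_(i < l) _; set q := \sum_(i < l) _.
set p' := exp_trunc l; set q' := _ *: 'X^l.
have -> : p^`() * p' + p * p'^`() - (q + q') * (p * p') =
          (p^`() - q * p) * p' + p * (p'^`() - q' * p') by ring.
by apply: dvdp_add; [apply: dvdp_mulr|apply: dvdp_mull; exact: exp_trunc_deriv].
Qed.

(** Compare the coefficients of X^m in P' = G P, which holds modulo X^n. *)
Lemma bell_poly_rec m : (m < n)%N ->
  m.+1%:R * bell_poly`_m.+1 =
  \sum_(i < m.+1) i.+1%:R * a i * bell_poly`_(m - i).
Proof.
move=> mn; have /dvdpP[s /(congr1 (fun p : {poly R} => p`_m))] := bell_poly_deriv.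
rewrite coefMXn mn coefB coef_deriv => /eqP; rewrite subr_eq0 mulr_natl => /eqP ->.
rewrite /bell_log_deriv -(poly_def _ (fun i => i.+1%:R * a i)) coefM.
apply: eq_bigr => i _; rewrite coef_poly (leq_trans _ mn)//.
Qed.

Lemma bell_poly0 : bell_poly`_0 = 1.
Proof.
rewrite -horner_coef0 /bell_poly horner_prod big1// => i _.
rewrite /exp_trunc horner_sum big_ord_recl big1 /= => [|j _].
  by rewrite muln0 !expr0 divr1 hornerZ hornerC mulr1 addr0.
by rewrite hornerZ hornerXn /bump /= add1n mulnS expr0n /= mulr0.
Qed.

Lemma coef_bell_poly m : bell_poly`_m =
  \sum_(f : {ffun 'I_n -> 'I_n.+1} | (\sum_(i < n) i.+1 * f i == m)%N)
     \prod_(i < n) (a i ^+ f i / (f i)`!%:R).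
Proof.
rewrite /bell_poly /exp_trunc bigA_distr_bigA /= coef_sum [RHS]big_mkcond /=.
apply: eq_bigr => f _.
rewrite scaler_prod -expr_sum coefZ coefXn eq_sym.
by case: eqP => _; rewrite ?mulr1 ?mulr0.
Qed.

End bell_generating_polynomial.

(** Each of the k blocks contributes one factor t, so t^k is absorbed in the variables and the sum
    over k drops the constraint on the number of blocks. *)
Lemma bell_sum_coef (R : realType) (w : nat -> R) (t : R) n :
  \sum_(0 <= k < n.+1) t ^+ k * bell w n k =
  n`!%:R * (bell_poly (fun i => t * w i.+1 / i.+1`!%:R) n)`_n.
Proof.
rewrite coef_bell_poly mulr_sumr big_mkord.
(* Blocks have size at least 1, so there are at most n of them and [inord] changes nothing. *)
rewrite (partition_big (fun m : {ffun 'I_n -> 'I_n.+1} =>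
  inord (\sum_(i < n) m i) : 'I_n.+1) predT) //=.
apply: eq_bigr => k _; rewrite /bell mulr_sumr; apply: eq_big => [m|m /andP[_ /eqP mk]].
  case: eqP => //= mn; rewrite -val_eqE /= inordK// ltnS -[leqRHS]mn.
  by apply: leq_sum => i _; rewrite leq_pmull.
rewrite -mk expr_sum mulrCA -!mulrA; congr (_ * _).
rewrite natr_prod -prodfV -!big_split /=; apply: eq_bigr => i _.
rewrite natrM natrX !exprMn exprVn invfM; ring.
Qed.

Lemma bell_sum_rising_transform (R : realType) (c t : R) (w : nat -> R) n :
  (forall n, w n.+1 = stirling_transform c (fun k => (stirling1 k 1)%:R) n.+1) ->
  \sum_(0 <= k < n.+1) t ^+ k * bell w n k = rising_transform c t n.
Proof.
move=> wE; rewrite bell_sum_coef.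
set a := fun i => _.
(* The order n of the truncated product stays fixed while the coefficient index m varies. *)
suff H m : (m <= n)%N -> m`!%:R * (bell_poly a n)`_m = rising_transform c t m by exact: H.
elim/ltn_ind: m => -[_ _|m IH mn]; first by rewrite bell_poly0 rising_transform0 mulr1.
rewrite factS mulnC natrM -mulrA bell_poly_rec// (rising_transform_bconv wE) !mulr_sumr.
apply: eq_bigr => i _; have im : (i <= m)%N by rewrite -ltnS.
rewrite -IH ?ltnS ?leq_subr ?(leq_trans (leq_subr _ _) (ltnW mn))//.
rewrite -(bin_fact im) /a factS !natrM invfM.
have f0 : i`!%:R != 0 :> R by rewrite pnatr_eq0 -lt0n fact_gt0.
field.
by rewrite f0 nat1r pnatr_eq0.
Qed.

(** * Power series *)

Section nonneg_power_series.
Context (R : realType).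

Lemma nneseries_cvg (u : nat -> R) (l : R) :
  series u x @[x --> \oo] --> l -> (\sum_(0 <= n <oo) (u n)%:E = l%:E)%E.
Proof.
move=> ul; apply/cvg_lim => //.
rewrite (_ : (fun n => _) = EFin \o series u).
  by apply: cvg_EFin; [exact: nearW|exact: ul].
by apply/funext => n /=; rewrite sumEFin.
Qed.

Lemma psum_le_nneseries (u : nat -> R) (l : R) n : (forall k, 0 <= u k) ->
  (\sum_(0 <= k <oo) (u k)%:E = l%:E)%E -> \sum_(0 <= k < n) u k <= l.
Proof.
move=> u0 ul; rewrite -lee_fin -sumEFin -ul.
by apply: nneseries_lim_ge => k _ _; rewrite lee_fin.
Qed.

Lemma nneseries_le_psum (u : nat -> R) (l M : R) n : (forall k, 0 <= u k) ->
  (\sum_(0 <= k <oo) (u k)%:E = l%:E)%E ->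
  (\sum_(n <= k <oo) (u k)%:E <= M%:E)%E -> l <= \sum_(0 <= k < n) u k + M.
Proof.
move=> u0 ul uM; rewrite -lee_fin EFinD -sumEFin -ul.
rewrite (nneseries_split 0 n) ?add0n; last by move=> k _; rewrite lee_fin.
exact: leeD2l.
Qed.

(** After the common lower terms cancel, divide by x^n: for 0 < x <= 1 the tail of the second series
    is at most x^(n+1) f(1), so a_n <= b_n + x f(1), and x can be taken small. *)
Lemma power_series_coef_le (a b : nat -> R) (f : R -> R) (n : nat) :
  (forall k, 0 <= a k) -> (forall k, 0 <= b k) ->
  (forall x, 0 < x -> x <= 1 -> (\sum_(0 <= k <oo) (a k * x ^+ k)%:E = (f x)%:E)%E) ->
  (forall x, 0 < x -> x <= 1 -> (\sum_(0 <= k <oo) (b k * x ^+ k)%:E = (f x)%:E)%E) ->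
  (forall k, (k < n)%N -> a k = b k) -> a n <= b n.
Proof.
move=> a0 b0 af bf ab.
have f1 : 0 <= f 1.
  rewrite -lee_fin -af// nneseries_ge0// => k _ _.
  by rewrite lee_fin mulr_ge0// exprn_ge0.
have key x : 0 < x -> x <= 1 -> a n <= b n + x * f 1.
  move=> x0 x1; have xk k : 0 <= x ^+ k by rewrite exprn_ge0// ltW.
  have := @psum_le_nneseries _ _ n.+1 (fun k => mulr_ge0 (a0 k) (xk k)) (af x x0 x1).
  have tail : (\sum_(n.+1 <= k <oo) (b k * x ^+ k)%:E <= (x ^+ n.+1 * f 1)%:E)%E.
    rewrite -nneseries_addn; last by move=> k; rewrite lee_fin mulr_ge0.
    have b1 k : (0 <= (b k * 1 ^+ k)%:E)%E by rewrite lee_fin mulr_ge0// exprn_ge0.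
    apply: (@le_trans _ _ (\sum_(0 <= i <oo)
        ((x ^+ n.+1)%:E * (b (i + n.+1)%N * 1 ^+ (i + n.+1)%N)%:E))%E).
      apply: lee_nneseries => k _; first by rewrite lee_fin mulr_ge0.
      rewrite -EFinM lee_fin expr1n mulr1 mulrC ler_wpM2r//.
      by rewrite ler_wiXn2l ?leq_addl// ltW.
    rewrite nneseriesZl// EFinM lee_wpmul2l ?lee_fin//.
    rewrite (nneseries_addn (f := fun k => (b k * 1 ^+ k)%:E))// -(bf 1)//.
    rewrite [leRHS](nneseries_split 0 n.+1)// leeDr//.
    by rewrite sume_ge0.
  move/(@nneseries_le_psum _ _ _ _ (fun k => mulr_ge0 (b0 k) (xk k)) (bf x x0 x1)) in tail.
  move=> /le_trans/(_ tail).
  rewrite !big_nat_recr//= (@eq_big_nat _ _ _ 0%N n _ (fun k => b k * x ^+ k)); last first.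
    by move=> k /andP[_ kn]; rewrite ab.
  rewrite -addrA lerD2l exprSr -mulrA [x ^+ n * _]mulrC -mulrDl ler_pM2r//.
  by rewrite exprn_gt0.
rewrite leNgt; apply/negP => ba.
(* If a_n > b_n, this point lies in ]0, 1] and satisfies e f(1) < a_n - b_n, which contradicts
   [key]. *)
pose e := (a n - b n) / (a n - b n + f 1 + 1).
have d0 : 0 < a n - b n by rewrite subr_gt0.
have D0 : 0 < a n - b n + f 1 + 1 by rewrite -addrA ltr_wpDr// addr_ge0.
have := key e (divr_gt0 d0 D0).
rewrite ler_pdivrMr// mul1r -addrA lerDl addr_ge0// => /(_ isT).
rewrite -lerBlDl leNgt => /negP; apply.
rewrite /e mulrAC ltr_pdivrMr// ltr_pM2l// -ltrBlDr.
by rewrite -subr_gt0; lra.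
Qed.

(** The interval ]0, 1] is the range of exp(- lambda) for lambda >= 0, so Laplace transforms can be
    compared. *)
Lemma power_series_inj (a b : nat -> R) (f : R -> R) :
  (forall k, 0 <= a k) -> (forall k, 0 <= b k) ->
  (forall x, 0 < x -> x <= 1 -> (\sum_(0 <= k <oo) (a k * x ^+ k)%:E = (f x)%:E)%E) ->
  (forall x, 0 < x -> x <= 1 -> (\sum_(0 <= k <oo) (b k * x ^+ k)%:E = (f x)%:E)%E) ->
  a = b.
Proof.
move=> a0 b0 af bf; apply/funext; elim/ltn_ind => n IH.
apply/eqP; rewrite eq_le (power_series_coef_le a0 b0 af bf)//.
by rewrite (power_series_coef_le b0 a0 bf af)// => k /IH.
Qed.

End nonneg_power_series.

(** * The binomial series with a nonnegative parameter *)

Section binomial_series.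
Context (R : realType).
Implicit Types (t x : R).

Let r t k : R := rising t k / k`!%:R.

Let p t N : {poly R} := \sum_(k < N.+1) r t k *: 'X^k.

Let rS t k : r t k.+1 * k.+1%:R = (t + k%:R) * r t k.
Proof.
rewrite /r risingS factS natrM; field.
by rewrite nat1r !pnatr_eq0 -!lt0n fact_gt0.
Qed.

Let r_ge0 t k : 0 <= t -> 0 <= r t k.
Proof. by move=> t0; rewrite divr_ge0// rising_ge0. Qed.

(** Truncated form of (1 - x) f' = t f, the equation solved by (1 - x)^(-t). *)
Let p_ode t N :
  (1 - 'X) * (p t N)^`() = t *: p t N - (r t N.+1 * N.+1%:R) *: 'X^N.
Proof.
elim: N => [|N IH].
  rewrite /p big_ord1 derivZ derivC scaler0 mulr0 rS addr0 scalerA -scalerBl.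
  by rewrite subrr scale0r.
rewrite /p big_ord_recr /= -/(p t N) derivD mulrDr IH derivZ derivXn /=.
rewrite (rS t N.+1) -mulr_natl -!mul_polyC exprS.
by rewrite !rmorphM rmorphD !rmorph_nat /=; ring.
Qed.

(* The derivative of the [N]-th partial sum times [(1 - x)^t] reduces to its last
   term, as the coefficients satisfy [(k + 1) r_(k+1) = (t + k) r_k]. *)
Lemma binomial_remainder t x N : 0 <= t -> 0 <= x -> x < 1 ->
  0 <= 1 - (p t N).[x] * expR (t * ln (1 - x))
    <= (1 - x)^-1 * (r t N.+1 * N.+1%:R * x ^+ N).
Proof.
move=> t0 x0 x1.
pose e y : R := expR (t * ln (1 - y)).
pose df y := - ((1 - y)^-1 * (r t N.+1 * N.+1%:R * y ^+ N) * e y).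
have dE (y : R) : y < 1 -> is_derive y 1 (fun y => (p t N).[y] * e y) (df y).
  move=> y1; have y10 : 0 < 1 - y by rewrite subr_gt0.
  have d1 : is_derive y 1 (fun y : R => 1 - y) (-1).
    by rewrite -[-1]sub0r; exact: is_deriveB.
  have d2 := @is_derive1_comp R (@ln R) (fun y => 1 - y) y _ _ (is_derive1_ln y10) d1.
  have d3 : is_derive y 1 (fun y => t * ln (1 - y)) (t * ((1 - y)^-1 * -1)).
    exact: is_deriveZ.
  have d4 := @is_derive1_comp R (@expR R) (fun y => t * ln (1 - y)) y
    _ _ (is_derive_expR (t * ln (1 - y))) d3.
  apply: (is_derive_eq (is_deriveM (is_derive_poly (p t N) y) d4)).
  have /(congr1 (horner^~ y)) := p_ode t N.
  rewrite !(hornerE, hornerXn) /= => H.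
  rewrite /df /e /GRing.scale /=.
  have -> : (p t N)^`().[y] = (1 - y)^-1 * (t * (p t N).[y] - r t N.+1 * N.+1%:R * y ^+ N).
    by rewrite -H mulKf// gt_eqF.
  ring.
(* The product p(y) (1 - y)^t equals 1 at y = 0, so the quantity to bound is minus its increment
   over [0, x]. *)
have [y||c cx] := @MVT_segment R (fun y => (p t N).[y] * e y) df 0 x x0.
- by rewrite in_itv /= => /andP[_ yx]; apply: dE; exact: lt_trans yx x1.
- apply: derivable_within_continuous => y; rewrite in_itv /= => /andP[_ yx].
  by have [] := dE y (le_lt_trans yx x1).
have -> : (p t N).[0] * e 0 = 1.
  rewrite /e subr0 ln1 mulr0 expR0 mulr1 horner_coef0 /p coef_sum big_ord_recl big1.
    by rewrite coefZ coefXn /= /r rising0 divr1 mulr1 addr0.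
  by move=> i _; rewrite coefZ coefXn mulr0.
rewrite subr0 => fx; rewrite -[X in 1 - X](subrK 1) -/(e x) fx.
move: cx; rewrite in_itv /= => /andP[c0 cx].
have c1 : 0 < 1 - c by rewrite subr_gt0 (le_lt_trans cx).
have r0 := r_ge0 N.+1 t0.
have -> : 1 - (df c * x + 1) =
    ((1 - c)^-1 * (r t N.+1 * N.+1%:R * c ^+ N)) * (e c * x) by rewrite /df; ring.
have ec0 : 0 <= e c by exact: expR_ge0.
move: (r t N.+1) r0 => rr r0; apply/andP; split.
  by rewrite !mulr_ge0 ?invr_ge0 ?exprn_ge0// ltW.
rewrite -[leRHS]mulr1 ler_pM//.
- by rewrite !mulr_ge0 ?invr_ge0 ?exprn_ge0// ltW.
- by rewrite mulr_ge0.
- apply: ler_pM; rewrite ?invr_ge0 ?mulr_ge0 ?exprn_ge0// ?(ltW c1)//.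
    by rewrite lef_pV2 ?posrE ?subr_gt0 ?(le_lt_trans cx x1)// lerD2l lerN2.
  by rewrite ler_wpM2l ?mulr_ge0// lerXn2r.
- rewrite mulr_ile1 ?(ltW x1)//.
  by rewrite -expR0 ler_expR mulr_ge0_le0// -ln1 ler_ln ?posrE// lerBlDr lerDl.
Qed.

Lemma cvg_binomial_series t x : 0 <= t -> 0 <= x -> x < 1 ->
  series (fun k => rising t k / k`!%:R * x ^+ k) n @[n --> \oo] -->
    expR (t * - ln (1 - x)).
Proof.
move=> t0 x0 x1.
have pE y N : series (fun k => rising t k / k`!%:R * y ^+ k) N.+1 = (p t N).[y].
  rewrite /series /= big_mkord /p horner_sum; apply: eq_bigr => i _.
  by rewrite hornerZ hornerXn.
have expK y : expR (t * ln (1 - y)) * expR (t * - ln (1 - y)) = 1.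
  by rewrite -expRD mulrN subrr expR0.
(* At a second point y between x and 1 the partial sums are bounded, because the remainder is
   nonnegative, so the terms r_n y^n tend to 0. They dominate the remainder at x, up to the constant
   [K] below. *)
pose y := (1 + x) / 2.
have xy : x < y by rewrite /y; lra.
have y1 : y < 1 by rewrite /y; lra.
have y0 : 0 <= y by rewrite ltW// (le_lt_trans x0).
have ydcvg : cvgn (series (fun k => rising t k / k`!%:R * y ^+ k)).
  apply: nondecreasing_is_cvgn.
    apply/nondecreasing_seqP => n; rewrite /series /= big_nat_recr//= lerDl.
    by rewrite mulr_ge0 ?exprn_ge0// divr_ge0// rising_ge0.
  exists (expR (t * - ln (1 - y))) => _ [n _ <-].
  apply: (@le_trans _ _ (series (fun k => rising t k / k`!%:R * y ^+ k) n.+1)).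
    rewrite /series /= big_nat_recr//= lerDl.
    by rewrite mulr_ge0 ?exprn_ge0// divr_ge0// rising_ge0.
  rewrite pE.
  have /andP[+ _] := binomial_remainder n t0 y0 y1.
  rewrite subr_ge0 => /(ler_wpM2r (expR_ge0 (t * - ln (1 - y)))).
  by rewrite -mulrA expK mulr1 mul1r.
have term0 : (fun n => (rising t n / n`!%:R * y ^+ n)) @ \oo --> 0.
  exact: cvg_series_cvg_0.
rewrite -(cvg_shiftS (series _)) /=.
under eq_fun do rewrite pE.
pose K := expR (t * - ln (1 - x)) * ((1 - x)^-1 * (y - x)^-1).
apply/cvgrPdist_le => e e0.
have : (fun n => K * (r t n.+1 * y ^+ n.+1)) @ \oo --> 0.
  rewrite -(mulr0 K); apply: cvgMr.
  by rewrite (cvg_shiftS (fun n => r t n * y ^+ n)).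
move=> /cvgrPdist_le/(_ e e0); apply: filterS => n.
rewrite sub0r normrN => ne.
have /andP[h1 h2] := binomial_remainder n t0 x0 x1.
have -> : expR (t * - ln (1 - x)) - (p t n).[x] =
    expR (t * - ln (1 - x)) * (1 - (p t n).[x] * expR (t * ln (1 - x))).
  by rewrite mulrBr mulr1 mulrCA [X in _ - _ * X]mulrC expK mulr1.
rewrite ger0_norm ?mulr_ge0 ?expR_ge0//.
apply: le_trans ne; apply: le_trans (ler_norm _).
set rr := r t n.+1 in h2 *; have rr0 : 0 <= rr by exact: r_ge0.
clearbody rr; rewrite /K -!mulrA ler_pM2l ?expR_gt0//; apply: (le_trans h2).
rewrite -!mulrA ler_pM2l ?invr_gt0 ?subr_gt0//.
rewrite [leRHS]mulrCA ler_wpM2l// ler_pdivlMl ?subr_gt0//.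
(* Bernoulli: y^(n+1) - x^(n+1) >= (y - x) (n+1) x^n *)
apply: (@le_trans _ _ (y ^+ n.+1 - x ^+ n.+1)); last by rewrite lerBlDr lerDl exprn_ge0.
rewrite subrXX ler_pM2l ?subr_gt0// mulr_natl.
apply: (@le_trans _ _ (\sum_(i < n.+1) x ^+ n)).
  by rewrite sumr_const card_ord.
apply: ler_sum => i _; have {1}-> : n = (n - i + i)%N by rewrite subnK// -ltnS.
rewrite exprD /=; apply: ler_wpM2r; first exact: exprn_ge0.
by rewrite lerXn2r ?nnegrE// ltW.
Qed.

End binomial_series.

Lemma mlog_ge0 (R : realType) (x : R) : 0 <= x -> x < 1 -> 0 <= - ln (1 - x).
Proof.
by move=> x0 x1; rewrite oppr_ge0 -ln1 ler_ln ?posrE ?subr_gt0// lerBlDr lerDl.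
Qed.

(** * Generating functions of the Stirling numbers *)

Section stirling_series.
Context (R : realType) (x : R) (x0 : 0 <= x) (x1 : x < 1).
Local Notation L := (- ln (1 - x)).

(** The defining expansion, stated for polynomials over [nat], is carried to real t by the
    recurrences. *)
Lemma rising_stirling t n : rising t n = stirling_transform t (fun=> 1 : R) n.
Proof.
elim: n => [|n IH].
  by rewrite rising0 /stirling_transform big_ord1 stirling10 expr0 !mulr1.
by rewrite risingS stirling_transformS -IH -mulrDl addrC mulrC.
Qed.

(** Tonelli for series; the inner sum over k stops at n because |s(n,k)| = 0 for k > n. *)
Lemma nneseries_stirling_swap (v : nat -> R) : (forall k, 0 <= v k) ->
  (\sum_(0 <= k <oo) (v k)%:E *
     (\sum_(0 <= n <oo) ((stirling1 n k)%:R / n`!%:R * x ^+ n)%:E) =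
  \sum_(0 <= n <oo) (stirling_transform 1 v n / n`!%:R * x ^+ n)%:E)%E.
Proof.
move=> v0; have s0 n k : 0 <= (stirling1 n k)%:R / n`!%:R * x ^+ n.
  by rewrite mulr_ge0 ?exprn_ge0// divr_ge0.
under eq_eseriesr => k _ do (rewrite -nneseriesZl; last by move=> n _; rewrite lee_fin).
rewrite nneseries_interchange; last by move=> k n; rewrite -EFinM lee_fin mulr_ge0.
apply: eq_eseriesr => n _; rewrite (nneseries_split 0 n.+1); last first.
  by move=> k _; rewrite -EFinM lee_fin mulr_ge0.
rewrite add0n eseries0 => [|k nk _]; last first.
  by rewrite stirling1_gt// !mul0r mule0.
rewrite adde0; under eq_bigr do rewrite -EFinM.
rewrite sumEFin big_mkord; congr EFin.
rewrite /stirling_transform !mulr_suml; apply: eq_bigr => k _.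
by rewrite expr1n mulr1; ring.
Qed.

Lemma stirling_series k :
  (\sum_(0 <= n <oo) ((stirling1 n k)%:R / n`!%:R * x ^+ n)%:E =
   (L ^+ k / k`!%:R)%:E)%E.
Proof.
set S := fun k => (\sum_(0 <= n <oo) ((stirling1 n k)%:R / n`!%:R * x ^+ n)%:E)%E.
have L0 : 0 <= L by exact: mlog_ge0.
have S0 j : (0 <= S j)%E.
  apply: nneseries_ge0 => n _ _.
  by rewrite lee_fin mulr_ge0 ?exprn_ge0// divr_ge0.
(* both sides of this identity are power series in [t] *)
have sumS t : 0 <= t -> (\sum_(0 <= j <oo) (t ^+ j)%:E * S j = (expR (t * L))%:E)%E.
  move=> t0; rewrite nneseries_stirling_swap; last by move=> j; exact: exprn_ge0.
  rewrite -(nneseries_cvg (cvg_binomial_series t0 x0 x1)).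
  apply: eq_eseriesr => n _; congr (_ / _ * _)%:E.
  by rewrite rising_stirling; apply: eq_bigr => i _; rewrite expr1n mulr1 mul1r.
(* Each [S j] is a term of the identity [sumS] at t = 1, whose total is finite. *)
have Sfin j : S j = (fine (S j))%:E.
  rewrite fineK// ge0_fin_numE//; apply: (@le_lt_trans _ _ (expR (1 * L))%:E); last exact: ltry.
  rewrite -sumS//.
  under eq_eseriesr do rewrite expr1n mul1e.
  apply: le_trans (nneseries_lim_ge j.+1 _) => //.
  by rewrite big_nat_recr//= leeDr// sume_ge0.
rewrite -/(S k) Sfin; congr EFin.
have /(congr1 (fun f => f k)) // : (fun j => fine (S j)) = (fun j => L ^+ j / j`!%:R).
apply: (@power_series_inj _ _ _ (fun t => expR (t * L))) => [j|j|t t0 t1|t t0 t1].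
- exact: fine_ge0.
- by rewrite divr_ge0// exprn_ge0.
- rewrite -sumS ?ltW//; apply: eq_eseriesr => j _.
  by rewrite EFinM -Sfin muleC.
- rewrite -(nneseries_cvg (is_cvg_series_exp_coeff (t * L))); apply: eq_eseriesr => j _.
  by rewrite /exp_coeff /= exprMn; congr EFin; ring.
Qed.

Lemma stirling_transform_series (c : R) (u : nat -> R) :
  0 <= c -> (forall k, 0 <= u k) ->
  (\sum_(0 <= n <oo) (stirling_transform c u n / n`!%:R * x ^+ n)%:E =
   \sum_(0 <= k <oo) (u k / k`!%:R * (c * L) ^+ k)%:E)%E.
Proof.
move=> c0 u0; transitivity (\sum_(0 <= k <oo) (u k * c ^+ k)%:E * (L ^+ k / k`!%:R)%:E)%E.
  under [RHS]eq_eseriesr do rewrite -stirling_series.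
  rewrite nneseries_stirling_swap; last by move=> k; rewrite mulr_ge0// exprn_ge0.
  apply: eq_eseriesr => n _; congr (_ / _ * _)%:E.
  by apply: eq_bigr => k _; rewrite expr1n mulr1.
by apply: eq_eseriesr => k _; rewrite -EFinM exprMn; congr EFin; ring.
Qed.

End stirling_series.

Section rising_transform_series.
Context (R : realType) (x c : R).
Hypotheses (x0 : 0 <= x) (x1 : x < 1) (c0 : 0 <= c) (cL1 : c * - ln (1 - x) < 1).

Let cL0 : 0 <= c * - ln (1 - x).
Proof. by rewrite mulr_ge0// mlog_ge0. Qed.

Lemma rising_transform_series t : 0 <= t ->
  (\sum_(0 <= n <oo) (rising_transform c t n / n`!%:R * x ^+ n)%:E =
   (expR (t * - ln (1 - c * - ln (1 - x))))%:E)%E.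
Proof.
move=> t0; rewrite stirling_transform_series// => [|k]; last exact: rising_ge0.
exact/nneseries_cvg/cvg_binomial_series.
Qed.

(** The case k = 1 of [stirling_series] is the logarithmic series, used here at the point c L(x). *)
Lemma log_series :
  (\sum_(0 <= n <oo)
     (stirling_transform c (fun k => (stirling1 k 1)%:R) n / n`!%:R * x ^+ n)%:E =
   (- ln (1 - c * - ln (1 - x)))%:E)%E.
Proof. by rewrite stirling_transform_series// stirling_series// expr1 divr1. Qed.

End rising_transform_series.

(** * Independence *)

Section measurable_composition.
Context d d' (S : measurableType d) (Omega : measurableType d') (R : realType).

(* Approximating [h] from above by multiples of [1 / n.+1] only uses right
   continuity of the paths. *)
Lemma measurable_random_time (V : R -> Omega -> R) (h : S -> R) (p : S -> Omega) :
  (forall t, 0 <= t -> measurable_fun [set: Omega] (V t)) ->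
  (forall w t, 0 <= t -> V s w @[s --> t^'+] --> V t w) ->
  measurable_fun [set: S] h -> (forall s, 0 <= h s) ->
  measurable_fun [set: S] p ->
  measurable_fun [set: S] (fun s => V (h s) (p s)).
Proof.
move=> mV rcV mh h0 mp.
pose a n s : R := (Num.truncn (n.+1%:R * h s)).+1%:R / n.+1%:R.
have ha n s : h s < a n s.
  by rewrite /a ltr_pdivlMr// mulrC truncnS_gt.
have ah n s : a n s <= h s + n.+1%:R^-1.
  rewrite /a ler_pdivrMr// mulrDl mulVf ?pnatr_eq0// -natr1 lerD2r mulrC.
  by rewrite truncn_le// mulr_ge0.
have cvga s : V (a n s) (p s) @[n --> \oo] --> V (h s) (p s).
  have /cvg_at_rightP := rcV (p s) (h s) (h0 s).
  apply; split => //.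
  apply/cvgrPdist_le => e e0.
  have := @near_infty_natSinv_lt R (PosNum e0).
  apply: filterS => n /ltW ne.
  rewrite distrC ger0_norm; last by rewrite subr_ge0 ltW.
  by rewrite lerBlDr (le_trans (ah n s))// addrC lerD2r.
apply: (measurable_fun_cvg (h := fun n s => V (a n s) (p s))) => // n.
(* On [E k] the approximating time is constant, and countably many such sets cover the space. *)
pose E k := [set s | Num.truncn (n.+1%:R * h s) = k].
have EE k : E k = (fun s => n.+1%:R * h s) @^-1` `[k%:R, k.+1%:R[%classic.
  apply/seteqP; split => s /=; rewrite /E /= in_itv /=.
    by move=> <-; rewrite truncn_le ?mulr_ge0//= truncnS_gt.
  by move=> ?; apply/truncn_def.
have mE k : measurable (E k).
  rewrite EE -[X in measurable X]setTI.
  by apply: measurable_funM.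
have -> : [set: S] = \bigcup_k E k.
  by rewrite eqEsubset; split => // s _; exists (Num.truncn (n.+1%:R * h s)).
apply/measurable_fun_bigcup => // k.
apply: (eq_measurable_fun (fun s => V (k.+1%:R / n.+1%:R) (p s))).
  by move=> s; rewrite inE /E /a /= => ->.
apply: measurable_funS (subsetT _) _ => //.
by apply: measurableT_comp => //; apply: mV; rewrite divr_ge0.
Qed.

End measurable_composition.

Lemma measurable_idfun_g_sigma d (Omega : measurableType d) (G : set_system Omega) :
  G `<=` measurable ->
  measurable_fun [set: Omega] (idfun : Omega -> g_sigma_algebraType G).
Proof.
move=> Gm _ B mB; rewrite setTI preimage_id.
by apply: (smallest_sub _ Gm) mB; exact: sigma_algebra_measurable.
Qed.

Section independence.
Context d (Omega : measurableType d) (R : realType) (P : probability Omega R).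
Local Open Scope ereal_scope.

Definition independent_classes (GX GT : set_system Omega) :=
  forall A B, <<s GX >> A -> <<s GT >> B -> P (A `&` B) = P A * P B.

Lemma ge0_integral_independent (GX GT : set_system Omega)
  (f : (g_sigma_algebraType GX * g_sigma_algebraType GT)%type -> \bar R) :
  GX `<=` measurable -> GT `<=` measurable -> independent_classes GX GT ->
  measurable_fun [set: g_sigma_algebraType GX * g_sigma_algebraType GT] f -> (forall x, 0 <= f x) ->
  \int[P]_w f (w, w) = \int[P]_w' \int[P]_w f (w, w').
Proof.
move=> GXm GTm ind mf f0.
pose iX : Omega -> g_sigma_algebraType GX := idfun.
pose iT : Omega -> g_sigma_algebraType GT := idfun.
have miX : measurable_fun setT iX by exact: measurable_idfun_g_sigma.
have miT : measurable_fun setT iT by exact: measurable_idfun_g_sigma.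
have mdiag : measurable_fun [set: Omega] (fun w => (iX w, iT w)).
  exact/measurable_fun_pairP.
pose PX := distribution P (HB.pack iX (isMeasurableFun.Build _ _ _ _ _ miX) : {mfun _ >-> _}).
pose PT := distribution P (HB.pack iT (isMeasurableFun.Build _ _ _ _ _ miT) : {mfun _ >-> _}).
transitivity (\int[pushforward P (fun w => (iX w, iT w))]_z f z).
  by rewrite ge0_integral_pushforward// => ? _.
transitivity (\int[PX \x PT]_z f z).
  (* The law of the diagonal map is the product measure: on rectangles this is the independence
     hypothesis. *)
  apply: eq_measure_integral => /= A mA _.
  apply/esym; apply: product_measure_unique => // A1 A2 mA1 mA2.
rewrite fubini_tonelli2//.
rewrite ge0_integral_pushforward//=; last 2 first.
  exact: measurable_fun_fubini_tonelli_G.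
  by move=> y _; exact: integral_ge0.
apply: eq_integral => w' _ /=; rewrite /fubini_G ge0_integral_pushforward//=.
apply: measurableT_comp => //; exact: measurable_pair2.
Qed.

End independence.

(** * Expectations of products of independent variables *)

Section independent_functions.
Context d (Omega : measurableType d) (R : realType) (P : probability Omega R).
Local Open Scope ereal_scope.
Import HBNNSimple.

(** From indicators to simple functions by linearity, then by monotone convergence. In the
    application [Z] is the product of the other factors and [K] its expectation. *)
Lemma ge0_integral_mul_comp (D : Omega -> R) (Z : Omega -> R) (K : R) (g : R -> R) :
  measurable_fun setT D -> measurable_fun setT Z -> (forall w, 0 <= Z w)%R ->
  (0 <= K)%R ->
  (forall B, measurable B ->
    \int[P]_w (Z w * \1_B (D w))%:E = K%:E * P (D @^-1` B)) ->
  measurable_fun setT g -> (forall x, 0 <= g x)%R ->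
  \int[P]_w (Z w * g (D w))%:E = K%:E * \int[P]_w (g (D w))%:E.
Proof.
move=> mD mZ Z0 K0 ZK mg g0.
have mEg : measurable_fun setT (EFin \o g) by exact/measurable_EFinP.
have Eg0 x : [set: R] x -> 0 <= (EFin \o g) x by rewrite lee_fin.
pose g_ := nnsfun_approx measurableT mEg.
have mDB (B : set R) : measurable B -> measurable (D @^-1` B).
  by move=> mB; rewrite -[X in measurable X]setTI; exact: mD.
have mgD n : measurable_fun setT (fun w => g_ n (D w)).
  exact: measurableT_comp.
have gD0 n w : (0 <= g_ n (D w))%R by exact: fun_ge0.
have simple n : \int[P]_w (Z w * g_ n (D w))%:E = K%:E * \int[P]_w (g_ n (D w))%:E.
  have mind y : measurable_fun setT (fun w => \1_(g_ n @^-1` [set y]) (D w) : R).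
    exact: measurableT_comp.
  have yg0 (y : R) (u : R) : (0 <= y * \1_(g_ n @^-1` [set y]) u)%R.
    rewrite indicE; have [/set_mem /= <-|_] := boolP (u \in _); last by rewrite mulr0.
    by rewrite mulr1; exact: fun_ge0.
  have gE u : (g_ n u)%:E =
      \sum_(y \in range (g_ n)) (y * \1_(g_ n @^-1` [set y]) u)%:E.
    by rewrite fsumEFin// -fimfunE.
  have gnn y : range (g_ n) y -> (0 <= y)%R by move=> [x _ <-]; exact: fun_ge0.
  under eq_integral => w _.
    rewrite EFinM gE ge0_mule_fsumr; last by move=> y; rewrite lee_fin.
    over.
  rewrite ge0_integral_fsum//; last 2 first.
  - move=> y; under eq_fun do rewrite -EFinM.
    by apply/measurable_EFinP; apply: measurable_funM => //; exact: measurable_funM.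
  - move=> y w _; rewrite -EFinM lee_fin mulr_ge0//.
  under [in RHS]eq_integral do rewrite gE.
  rewrite ge0_integral_fsum//; last 2 first.
  - by move=> y; apply/measurable_EFinP; exact: measurable_funM.
  - by move=> y w _; rewrite lee_fin.
  rewrite ge0_mule_fsumr; last by move=> y; apply: integral_ge0 => w _; rewrite lee_fin.
  apply: eq_fsbigr => y /set_mem/gnn y0.
  under eq_integral do rewrite -EFinM mulrCA EFinM.
  rewrite ge0_integralZl_EFin//; last 2 first.
  - by move=> w _; rewrite lee_fin mulr_ge0.
  - by apply/measurable_EFinP; exact: measurable_funM.
  under [in RHS]eq_integral do rewrite EFinM.
  rewrite ge0_integralZl_EFin//; last exact/measurable_EFinP.
  rewrite ZK// muleCA; congr (_ * (_ * _)).
  rewrite (_ : (fun w => _) = (fun w => (\1_(D @^-1` (g_ n @^-1` [set y])) w)%:E))//.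
  by rewrite integral_indic ?setIT//; exact: mDB.
have cvgg w : (g_ n (D w))%:E @[n --> \oo] --> (g (D w))%:E.
  exact: (cvg_nnsfun_approx measurableT mEg Eg0).
have gnd w : {homo (fun n => (g_ n (D w))%:E) : n m / (n <= m)%N >-> n <= m}.
  by move=> n m nm; rewrite lee_fin; exact/lefP/nd_nnsfun_approx.
have cvgR : \int[P]_w (g_ n (D w))%:E @[n --> \oo] --> \int[P]_w (g (D w))%:E.
  rewrite [X in _ --> X](_ : _ = \int[P]_w (limn (fun n => (g_ n (D w))%:E))).
    apply: cvg_monotone_convergence => //.
      by move=> n; exact/measurable_EFinP.
    by move=> n w _; rewrite lee_fin.
  by apply: eq_integral => w _; apply/esym/cvg_lim.
have cvgL : \int[P]_w (Z w * g_ n (D w))%:E @[n --> \oo] --> \int[P]_w (Z w * g (D w))%:E.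
  rewrite [X in _ --> X](_ : _ = \int[P]_w (limn (fun n => (Z w * g_ n (D w))%:E))).
    apply: cvg_monotone_convergence => //.
    - by move=> n; apply/measurable_EFinP; exact: measurable_funM.
    - by move=> n w _; rewrite lee_fin mulr_ge0.
    - by move=> w _ n m nm; rewrite !EFinM lee_wpmul2l ?lee_fin//; exact: gnd.
  apply: eq_integral => w _; apply/esym/cvg_lim => //.
  by under eq_fun do rewrite EFinM; rewrite EFinM; exact: cvgeZl.
have cvgK : \int[P]_w (Z w * g_ n (D w))%:E @[n --> \oo] -->
    K%:E * \int[P]_w (g (D w))%:E.
  by under eq_fun do rewrite simple; exact: cvgeZl.
exact: cvg_unique cvgL cvgK.
Qed.

(** The bound by 1 keeps every integral finite, so the product of all of them but one is a real
    constant, as [ge0_integral_mul_comp] requires. *)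
Lemma independent_integral_prod n (D h : nat -> _ -> R) :
  (forall i, (i < n)%N -> measurable_fun [set: Omega] (D i)) ->
  (forall B : nat -> set R, (forall i, measurable (B i)) ->
    P (\bigcap_(i < n) (D i @^-1` B i)) = \prod_(i < n) P (D i @^-1` B i)) ->
  (forall i, measurable_fun [set: R] (h i)) ->
  (forall i x, 0 <= h i x <= 1)%R ->
  \int[P]_w (\prod_(i < n) h i (D i w))%:E = \prod_(i < n) \int[P]_w (h i (D i w))%:E.
Proof.
move=> mD indep mh h01.
(* induction on the number of factors that are not indicator functions *)
suff H j (B : nat -> set R) : (forall i, measurable (B i)) ->
    forall h : nat -> R -> R, (forall i, measurable_fun [set: R] (h i)) ->
    (forall i x, 0 <= h i x <= 1)%R ->
    (forall i, (j <= i < n)%N -> h i = \1_(B i)) ->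
    \int[P]_w (\prod_(i < n) h i (D i w))%:E = \prod_(i < n) \int[P]_w (h i (D i w))%:E.
  apply: (H n (fun=> setT)) => // i /andP[ni].
  by rewrite ltnNge ni.
elim: j B => [|j IH] B mB {}h {}mh {}h01 hB.
  have mDB i : (i < n)%N -> measurable (D i @^-1` B i).
    by move=> i_n; rewrite -[X in measurable X]setTI; exact: mD.
  under eq_integral => w _.
    rewrite (_ : \prod_(i < n) _ = \1_(\bigcap_(i < n) (D i @^-1` B i)) w)%R; last first.
      rewrite bigcap_mkord.
      elim/big_rec2 : _ => [|i y1 y2 _ ->]; first by rewrite indicE in_setT.
      by rewrite hB ?ltn_ord// indicI.
    over.
  rewrite integral_indic ?setIT//; last first.
    by apply: fin_bigcap_measurable => // i; exact: mDB.
  apply: (etrans (indep B mB)); apply: eq_bigr => i _.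
  rewrite (_ : (fun w => _) = (fun w => (\1_(D i @^-1` B i) w)%:E)); last first.
    by apply/funext => w; rewrite hB ?ltn_ord.
  by rewrite integral_indic ?setIT//; exact: mDB.
have [nj|jn] := leqP n j.
  apply: (IH B) => // i /andP[ji i_n].
  by move: (leq_ltn_trans (leq_trans nj ji) i_n); rewrite ltnn.
have mhD i : (i < n)%N -> measurable_fun setT (fun w => h i (D i w)).
  by move=> i_n; apply: measurableT_comp => //; exact: mD.
have h0 i x : (0 <= h i x)%R by have /andP[] := h01 i x.
have inth i : (i < n)%N -> (0 <= \int[P]_w (h i (D i w))%:E <= 1).
  move=> i_n; rewrite integral_ge0/= => [|w _]; last by rewrite lee_fin.
  apply: (@le_trans _ _ (\int[P]_w cst 1 w)); last first.
    by rewrite integral_cst// mul1e probability_le1.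
  apply: ge0_le_integral => //.
  - by move=> w _; rewrite lee_fin.
  - by apply/measurable_EFinP; exact: mhD.
  - by move=> w _; rewrite lee_fin; have /andP[] := h01 i (D i w).
pose jo := Ordinal jn.
pose Z w := (\prod_(i < n | i != jo) h i (D i w))%R.
have Kfin : \prod_(i < n | i != jo) \int[P]_w (h i (D i w))%:E \is a fin_num.
  elim/big_ind : _ => // [x y|i _]; first exact: fin_numM.
  by have /andP[i0 i1] := inth i (ltn_ord i); rewrite ge0_fin_numE// (le_lt_trans i1)// ltry.
under eq_integral => w _ do rewrite (bigD1 jo)//= mulrC.
rewrite (bigD1 jo)//= muleC -(fineK Kfin).
apply: (ge0_integral_mul_comp (Z := Z)) => //.
- exact: mD.
- rewrite /Z; under eq_fun do rewrite big_mkcond /=.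
  apply: (measurable_prod (h := fun (i : 'I_n) w =>
    if i != jo then h i (D i w) else 1%R)) => i _.
  by case: (i != jo) => //; exact: mhD.
- by move=> w; apply: prodr_ge0.
- rewrite fine_ge0// prode_ge0// => i _.
  by have /andP[] := inth i (ltn_ord i).
- move=> B0 mB0; rewrite fineK//.
  (* With [h j] replaced by an indicator, one fewer factor is arbitrary and the induction hypothesis
     applies. *)
  pose h' i := if i == j then \1_B0 else h i.
  pose B' i := if i == j then B0 else B i.
  have hj : h' j = \1_B0 by rewrite /h' eqxx.
  have hi i : i != j -> h' i = h i by rewrite /h' => /negbTE ->.
  have : \int[P]_w (\prod_(i < n) h' i (D i w))%:E =
      \prod_(i < n) \int[P]_w (h' i (D i w))%:E.
    apply: (IH B').
    + by move=> i; rewrite /B'; case: ifP.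
    + by move=> i; rewrite /h'; case: ifP.
    + move=> i x; rewrite /h'; case: ifP => // _.
      by rewrite indicE; case: (x \in B0); rewrite ?lexx ?ler01.
    + move=> i /andP[ji i_n]; rewrite /h' /B'; case: ifPn => // ij.
      by apply: hB; rewrite i_n andbT ltn_neqAle eq_sym ij.
  under eq_integral => w _.
    rewrite (bigD1 jo)//= hj mulrC.
    under eq_bigr => i ij do rewrite (hi _ ij).
    over.
  rewrite (bigD1 jo)//= hj.
  under [X in _ = _ * X -> _]eq_bigr => i ij do rewrite (hi _ ij).
  move=> ->; rewrite muleC; congr (_ * _).
  rewrite (_ : (fun w => _) = (fun w => (\1_(D j @^-1` B0) w)%:E))//.
  rewrite integral_indic ?setIT//.
  by rewrite -[X in measurable X]setTI; exact: mD.
Qed.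
End independent_functions.

(** * Subordination *)

Section subordination.
Context d (Omega : measurableType d) (R : realType) (P : probability Omega R).
Variables (X T : R -> Omega -> R).
Hypotheses (levyX : levy_process P X) (subT : subordinator P T)
  (indXT : independent_processes P X T).

Let GX := [set A | exists (t : R) (B : set R),
  [/\ 0 <= t, measurable B & A = X t @^-1` B]].
Let GT := [set A | exists (t : R) (B : set R),
  [/\ 0 <= t, measurable B & A = T t @^-1` B]].

Let GXm : GX `<=` measurable.
Proof.
move=> _ [t [B [t0 mB ->]]]; rewrite -[X in measurable X]setTI.
exact: (levy_measurable levyX).
Qed.

Let GTm : GT `<=` measurable.
Proof.
move=> _ [t [B [t0 mB ->]]]; rewrite -[X in measurable X]setTI.
by case: subT => levyT _; exact: (levy_measurable levyT).
Qed.

Let mX t : 0 <= t -> measurable_fun [set: g_sigma_algebraType GX] (X t).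
Proof.
move=> t0 _ B mB; rewrite setTI; apply: sub_gen_smallest.
by exists t, B.
Qed.

Let mT t : 0 <= t -> measurable_fun [set: g_sigma_algebraType GT] (T t).
Proof.
move=> t0 _ B mB; rewrite setTI; apply: sub_gen_smallest.
by exists t, B.
Qed.

Lemma subordinator_ge0 t w : 0 <= t -> 0 <= T t w.
Proof.
move=> t0; case: subT => levyT /(_ w 0 t (lexx 0) t0).
by rewrite (levy_start levyT) subr0.
Qed.

Let mXT t : 0 <= t ->
  measurable_fun [set: g_sigma_algebraType GX * g_sigma_algebraType GT]
    (fun z => X (T t z.2) z.1).
Proof.
move=> t0; apply: measurable_random_time => //.
- exact: (levy_right_continuous levyX).
- by apply: measurableT_comp => //; exact: mT.
- by move=> z; exact: subordinator_ge0.
Qed.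

Lemma measurable_subordinate t : 0 <= t ->
  measurable_fun [set: Omega] (subordinate X T t).
Proof.
move=> t0; case: subT => levyT _; apply: (measurable_random_time (p := idfun)) => //.
- exact: (levy_measurable levyX).
- exact: (levy_right_continuous levyX).
- exact: (levy_measurable levyT).
- by move=> w; exact: subordinator_ge0.
- exact: measurable_id.
Qed.

Lemma ge0_integral_subordinate (t : R) (f : R -> \bar R) : 0 <= t ->
  measurable_fun setT f -> (forall x, 0 <= f x)%E ->
  (\int[P]_w f (subordinate X T t w) = \int[P]_w' \int[P]_w f (X (T t w') w))%E.
Proof.
move=> t0 mf f0; rewrite (ge0_integral_independent (GX := GX) (GT := GT)
  (f := fun z => f (X (T t z.2) z.1)) GXm GTm indXT)//.
by apply: measurableT_comp => //; exact: mXT.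
Qed.

(** Total probability: an event on the two paths is averaged over the path of [T], held fixed. *)
Let probability_mix (F : set (Omega * Omega)) :
  measurable (F : set (g_sigma_algebraType GX * g_sigma_algebraType GT)) ->
  (P [set w | F (w, w)] = \int[P]_w' P [set w | F (w, w')])%E.
Proof.
move=> mF.
pose iX : Omega -> g_sigma_algebraType GX := idfun.
pose iT : Omega -> g_sigma_algebraType GT := idfun.
have miX : measurable_fun setT iX by exact: measurable_idfun_g_sigma.
have miT : measurable_fun setT iT by exact: measurable_idfun_g_sigma.
have mFd : measurable [set w | F (w, w)].
  rewrite -[X in measurable X]setTI.
  exact: (measurable_fun_pair miX miT measurableT mF).
have mFs w' : measurable [set w | F (w, w')].
  rewrite -[X in measurable X]setTI.
  exact: (measurable_fun_pair miX (measurable_cst (iT w')) measurableT mF).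
transitivity (\int[P]_w (\1_F (w, w))%:E)%E.
  by rewrite (_ : (fun w => _) = (fun w => (\1_[set w | F (w, w)] w)%:E))
    ?integral_indic ?setIT.
rewrite (ge0_integral_independent (GX := GX) (GT := GT) (f := fun z => (\1_F z)%:E))//; last first.
  by apply/measurable_EFinP; exact: measurable_indic.
apply: eq_integral => w' _.
by rewrite (_ : (fun w => _) = (fun w => (\1_[set w | F (w, w')] w)%:E))
  ?integral_indic ?setIT.
Qed.

Let measurable_X_preimage (B : set R) u : measurable B -> 0 <= u ->
  measurable [set w | B (X u w)].
Proof.
move=> mB u0; rewrite -[X in measurable X]setTI.
exact: (levy_measurable levyX).
Qed.

(* The maximum makes the law measurable in [u] on the whole line, the values of
   [X] at negative times being arbitrary. *)
Definition increment_law (B : set R) (u : R) : R := fine (P [set w | B (X (Num.max 0 u) w)]).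

Let increment_lawE (B : set R) u : measurable B -> 0 <= u ->
  (P [set w | B (X u w)] = (increment_law B u)%:E).
Proof.
move=> mB u0; rewrite /increment_law max_r// fineK//.
by apply: fin_num_measure; exact: measurable_X_preimage.
Qed.

Let measurable_increment_law B : measurable B ->
  measurable_fun [set: R] (increment_law B).
Proof.
move=> mB.
(* The law at time u is the measure of a section of [H], and section measures are measurable. *)
pose H := [set z : Omega * R | B (X (Num.max 0 z.2) z.1)].
have mH : measurable H.
  rewrite -[X in measurable X]setTI.
  apply: (@measurable_random_time _ _ (Omega * R)%type Omega R X
    (fun z => Num.max 0 z.2) fst) => //.
  - exact: (levy_measurable levyX).
  - exact: (levy_right_continuous levyX).
  - exact: measurable_maxr.
  - by move=> z; rewrite le_max lexx.
apply/measurable_EFinP; apply: eq_measurable_fun (measurable_fun_ysection P mH) => u _.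
rewrite /= /increment_law fineK.
  by congr (P _); apply/seteqP; split => w /=; rewrite /ysection /= inE.
by apply: fin_num_measure; apply: measurable_X_preimage; rewrite // le_max lexx.
Qed.

Let increment_law01 B u : measurable B -> 0 <= increment_law B u <= 1.
Proof.
move=> mB; rewrite fine_ge0//=.
have mXB : measurable [set w | B (X (Num.max 0 u) w)].
  by apply: measurable_X_preimage; rewrite // le_max lexx.
by rewrite -lee_fin fineK ?fin_num_measure// probability_le1.
Qed.

Let levyT : levy_process P T.
Proof. by case: subT. Qed.

Let T_mono s t w : 0 <= s -> s <= t -> T s w <= T t w.
Proof. by move=> s0 st; rewrite -subr_ge0; case: subT => _; exact. Qed.

(** For a fixed path of [T] the times T(t_i) form a nondecreasing sequence of constants, so
    independence and stationarity of the increments of [X] apply. *)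
Let joint_law n (t : nat -> R) (B : nat -> set R) :
  0 <= t 0%N -> (forall i, t i <= t i.+1) -> (forall i, measurable (B i)) ->
  (P (\bigcap_(i < n) [set w | B i (subordinate X T (t i.+1) w - subordinate X T (t i) w)%R]) =
   \int[P]_w (\prod_(i < n) increment_law (B i) (T (t i.+1) w - T (t i) w)%R)%:E)%E.
Proof.
move=> t00 tS mB.
have t0 i : 0 <= t i by elim: i => // i IH; exact: le_trans (tS i).
pose F := \bigcap_(i < n) [set z : Omega * Omega |
  B i (X (T (t i.+1) z.2) z.1 - X (T (t i) z.2) z.1)].
transitivity (P [set w | F (w, w)]); first by [].
rewrite probability_mix; last first.
  apply: fin_bigcap_measurable => // i _.
  rewrite -[X in measurable X]setTI.
  by apply: (measurable_funB (mXT (t0 i.+1)) (mXT (t0 i))).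
apply: eq_integral => w' _.
have Tt0 i : 0 <= T (t i) w' by exact: subordinator_ge0.
have TtS i : T (t i) w' <= T (t i.+1) w' by exact: T_mono.
apply: (etrans (levy_independent_increments levyX n (Tt0 0%N) TtS mB)).
rewrite -prodEFin; apply: eq_bigr => i _.
rewrite -increment_lawE ?subr_ge0//.
rewrite -(levy_stationary_increments levyX (Tt0 i)) ?subr_ge0//.
by rewrite subrKC.
Qed.

Let increment_subordinate s t (B : set R) : 0 <= s -> s <= t -> measurable B ->
  (P [set w | B (subordinate X T t w - subordinate X T s w)%R] =
   \int[P]_w (increment_law B (T t w - T s w)%R)%:E)%E.
Proof.
move=> s0 st mB.
(* A single increment, for the times s, t, t, ... *)
have := @joint_law 1 (fun i => if i is 0%N then s else t) (fun=> B) s0.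
rewrite bigcap_mkord big_ord1 /=; under eq_integral do rewrite big_ord1.
by apply=> // -[|i].
Qed.

Lemma levy_process_subordinate : levy_process P (subordinate X T).
Proof.
split.
- exact: measurable_subordinate.
- by move=> w; rewrite /subordinate (levy_start levyT) (levy_start levyX).
- move=> n t B t00 tS mB; rewrite joint_law//.
  have t0 i : 0 <= t i by elim: i => // i IH; exact: le_trans (tS i).
  rewrite (independent_integral_prod (D := fun i w => T (t i.+1) w - T (t i) w)
    (h := fun i => increment_law (B i))) //.
  + by apply: eq_bigr => i _; rewrite increment_subordinate.
  + move=> i _; apply: measurable_funB; exact: (levy_measurable levyT).
  + by move=> C mC; exact: (levy_independent_increments levyT).
  + by move=> i; exact: measurable_increment_law.
  + by move=> i x; exact: increment_law01.
- move=> s t B s0 t0 mB.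
  (* The integral depends on [f] only through its law, so stationarity of [T] carries over. *)
  have pushE f : measurable_fun setT f ->
      (\int[P]_w (increment_law B (f w))%:E =
       \int[pushforward P f]_u (increment_law B u)%:E)%E.
    move=> mf; rewrite ge0_integral_pushforward//.
      by apply/measurable_EFinP; exact: measurable_increment_law.
    by move=> u _; rewrite lee_fin; have /andP[] := increment_law01 u mB.
  have mst : measurable_fun setT (fun w => T (s + t) w - T s w).
    by apply: measurable_funB; apply: (levy_measurable levyT) => //; exact: addr_ge0.
  have mTt : measurable_fun setT (T t) by exact: (levy_measurable levyT).
  rewrite increment_subordinate ?lerDl//.
  transitivity (\int[P]_w (increment_law B (T t w))%:E)%E; last first.
    have <- : [set w | B (subordinate X T t w - subordinate X T 0 w)] =
        [set w | B (subordinate X T t w)].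
      apply/seteqP; split => w /=;
        by rewrite /subordinate (levy_start levyT) (levy_start levyX) subr0.
    by rewrite increment_subordinate//; apply: eq_integral => w _; rewrite (levy_start levyT) subr0.
  rewrite !pushE//; apply: eq_measure_integral => C mC _.
  exact: (levy_stationary_increments levyT).
- move=> w t t0 A AX.
  have XA : \forall u \near (T t w)^'+, A (X u w).
    exact: (levy_right_continuous levyX (subordinator_ge0 w t0)).
  rewrite near_withinE in XA.
  have := levy_right_continuous levyT t0 XA.
  apply: filterS2 (nbhs_right_gt t) => s ts /=.
  (* Either [T] has moved strictly to the right, where right continuity of [X] applies, or it has
     not moved and [Y] keeps its value. *)
  have := T_mono w t0 (ltW ts); rewrite le_eqVlt => /predU1P[E _|lt]; last by apply.
  by have := nbhs_singleton AX; rewrite /subordinate E.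
- move=> w t t0.
  have /cvg_ex[l Tl] := levy_left_limits levyT (w := w) t0.
  have near0 : \forall s \near t^'-, 0 <= s /\ s < t.
    by near do split => //; exact: nbhs_left_ge.
  have Tle s : 0 <= s -> s < t -> T s w <= l.
    move=> s0 st; rewrite -(cvg_lim _ Tl)//; apply: limr_ge; first by apply/cvg_ex; exists l.
    near=> s'; apply: T_mono => //.
    by near: s'; exact: nbhs_left_ge.
  (* If [T] reaches its left limit l before t, then [Y] is constant just before t; otherwise [T]
     stays strictly below l and [X] has a left limit at l. *)
  have [[s0 [s00 s0t Ts0]]|Tlt] := pselect (exists s0, [/\ 0 <= s0, s0 < t & T s0 w = l]).
    apply/cvg_ex; exists (X l w); apply: cvg_near_cst.
    near=> s; rewrite /subordinate; congr (X _ w); apply/eqP; rewrite eq_le.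
    rewrite Tle; last 2 first.
    + by near: s; exact: nbhs_left_ge.
    + by near: s; exact: nbhs_left_lt.
    rewrite -Ts0 T_mono//.
    by near: s; exact: nbhs_left_ge.
  have {}Tlt s : 0 <= s -> s < t -> T s w < l.
    move=> s0 st; rewrite lt_neqAle Tle// andbT; apply/eqP => Tsl.
    by apply: Tlt; exists s.
  have l0 : 0 < l by rewrite -(levy_start levyT w) Tlt.
  have /cvg_ex[L XL] := levy_left_limits levyX (w := w) l0.
  apply/cvg_ex; exists L => A AL.
  have XA : \forall u \near l^'-, A (X u w) by exact: XL AL.
  rewrite near_withinE in XA.
  apply: filterS2 near0 (Tl _ XA) => s [s0 st] /=; apply.
  exact: Tlt.
Unshelve. all: by end_near. Qed.

End subordination.

(** * The Negative-Binomial process at Gamma times *)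

Section composed_exponent.
Context (R : realType) (alpha beta : R).
Hypotheses (alpha0 : 0 < alpha) (alpha1 : alpha < 1) (beta0 : 0 < beta).
Local Notation A := (- ln (1 - alpha)).
Local Notation c := (beta / (1 + A * beta)).

Let A0 : 0 <= A. Proof. by rewrite mlog_ge0// ltW. Qed.

Let D0 : 0 < 1 + A * beta.
Proof. by rewrite ltr_pwDl// mulr_ge0// ltW. Qed.

Lemma composed_c_ge0 : 0 <= c.
Proof. by rewrite divr_ge0// ltW. Qed.

Let alphaz_lt1 z : 0 <= z -> z <= 1 -> alpha * z < 1.
Proof. by move=> z0 z1; rewrite (le_lt_trans _ alpha1)// ger_pMr. Qed.

(** The left side is at most c A = A beta / (1 + A beta) < 1. *)
Lemma composed_c_log_lt1 z : 0 <= z -> z <= 1 -> c * - ln (1 - alpha * z) < 1.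
Proof.
move=> z0 z1; apply: (@le_lt_trans _ _ (c * A)).
  rewrite ler_wpM2l ?composed_c_ge0// lerN2 ler_ln ?posrE ?subr_gt0 ?alphaz_lt1//.
  by rewrite lerD2l lerN2 ger_pMr.
by rewrite mulrAC ltr_pdivrMr// mul1r mulrC ltrDr.
Qed.

Lemma composed_expE z : 0 <= z -> z <= 1 ->
  1 + beta * ln ((1 - alpha * z) / (1 - alpha)) =
  (1 + A * beta) * (1 - c * - ln (1 - alpha * z)).
Proof.
move=> z0 z1; rewrite lnM ?posrE ?invr_gt0 ?subr_gt0 ?alphaz_lt1// lnV ?posrE ?subr_gt0//.
have D0' : 1 + A * beta != 0 by rewrite gt_eqF.
by field.
Qed.

Lemma composed_ln z : 0 <= z -> z <= 1 ->
  ln (1 + beta * ln ((1 - alpha * z) / (1 - alpha))) =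
  ln (1 + A * beta) + ln (1 - c * - ln (1 - alpha * z)).
Proof.
move=> z0 z1; rewrite composed_expE// lnM ?posrE//.
by rewrite subr_gt0 composed_c_log_lt1.
Qed.

Lemma composed_log_at1 : - ln (1 - c * A) = ln (1 + A * beta).
Proof.
have cA1 : c * A < 1 by have := composed_c_log_lt1 ler01 (lexx 1); rewrite mulr1.
rewrite -lnV; last by rewrite posrE subr_gt0.
congr ln; have D0' : 1 + A * beta != 0 by rewrite gt_eqF.
have -> : 1 - c * A = (1 + A * beta)^-1 by field.
by rewrite invrK.
Qed.

Definition composed_pmf t n : R :=
  alpha ^+ n / n`!%:R * ((1 + A * beta) `^ t)^-1 * rising_transform c t n.

Lemma composed_pmf_ge0 t n : 0 <= t -> 0 <= composed_pmf t n.
Proof.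
move=> t0; rewrite !mulr_ge0 ?invr_ge0 ?powR_ge0 ?exprn_ge0 ?(ltW alpha0)//.
by apply: stirling_transform_ge0 => [|k]; rewrite ?composed_c_ge0 ?rising_ge0.
Qed.

Lemma composed_pmf_series t z : 0 <= t -> 0 <= z -> z <= 1 ->
  (\sum_(0 <= n <oo) (composed_pmf t n * z ^+ n)%:E =
   (expR (- t * ln (1 + beta * ln ((1 - alpha * z) / (1 - alpha)))))%:E)%E.
Proof.
move=> t0 z0 z1.
have az0 : 0 <= alpha * z by rewrite mulr_ge0// ltW.
have rs := rising_transform_series az0 (alphaz_lt1 z0 z1) composed_c_ge0
  (composed_c_log_lt1 z0 z1) t0.
have q0 n : 0 <= rising_transform c t n.
  by apply: stirling_transform_ge0 => [|k]; rewrite ?composed_c_ge0 ?rising_ge0.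
transitivity ((((1 + A * beta) `^ t)^-1)%:E *
    \sum_(0 <= n <oo) (rising_transform c t n / n`!%:R * (alpha * z) ^+ n)%:E)%E.
  rewrite -nneseriesZl; last first.
    by move=> n _; rewrite lee_fin mulr_ge0 ?exprn_ge0// divr_ge0.
  apply: eq_eseriesr => n _; rewrite -EFinM; congr EFin.
  by rewrite /composed_pmf exprMn; ring.
rewrite rs -EFinM composed_ln// /powR gt_eqF// -expRN -expRD; congr (expR _)%:E.
ring.
Qed.

(** Writing (k - 1)! as |s(k,1)| makes the term k = 0 vanish, so the sum may start at 0. *)
Definition composed_levy n : R := alpha ^+ n / n`!%:R *
  stirling_transform c (fun k => (stirling1 k 1)%:R) n.

Lemma composed_levy_ge0 n : 0 <= composed_levy n.
Proof.
rewrite !mulr_ge0 ?invr_ge0 ?exprn_ge0 ?(ltW alpha0)//.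
by apply: stirling_transform_ge0 => [|k]; rewrite ?composed_c_ge0.
Qed.

Lemma composed_levy_series z : 0 <= z -> z <= 1 ->
  (\sum_(1 <= n <oo) (z ^+ n * composed_levy n)%:E =
   (- ln (1 - c * - ln (1 - alpha * z)))%:E)%E.
Proof.
move=> z0 z1; have az0 : 0 <= alpha * z by rewrite mulr_ge0// ltW.
rewrite -(log_series az0 (alphaz_lt1 z0 z1) composed_c_ge0 (composed_c_log_lt1 z0 z1)).
have E n : stirling_transform c (fun k => (stirling1 k 1)%:R) n / n`!%:R * (alpha * z) ^+ n =
    z ^+ n * composed_levy n by rewrite /composed_levy exprMn; ring.
under [RHS]eq_eseriesr do rewrite E.
rewrite [RHS](nneseries_split 0 1) ?add0n; last first.
  by move=> k _; rewrite lee_fin mulr_ge0 ?exprn_ge0 ?composed_levy_ge0.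
rewrite big_nat1 /composed_levy /stirling_transform big_ord1 !stirling10 /=.
by rewrite !mul0r !mulr0 add0e.
Qed.

(** The generating function at 1, which is the total mass, minus the one at z; both are finite, so
    the subtraction is legitimate. *)
Lemma composed_levy_khintchine z : 0 <= z -> z <= 1 ->
  (\sum_(1 <= n <oo) ((1 - z ^+ n) * composed_levy n)%:E =
   (ln (1 + beta * ln ((1 - alpha * z) / (1 - alpha))))%:E)%E.
Proof.
move=> z0 z1.
have zn n : z ^+ n <= 1 by exact: exprn_ile1.
have : (\sum_(1 <= n <oo) ((1 - z ^+ n) * composed_levy n)%:E +
    \sum_(1 <= n <oo) (z ^+ n * composed_levy n)%:E =
    \sum_(1 <= n <oo) (1 ^+ n * composed_levy n)%:E)%E.
  rewrite -nneseriesD; last 2 first.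
  - by move=> n _ _; rewrite lee_fin mulr_ge0 ?composed_levy_ge0// subr_ge0.
  - by move=> n _ _; rewrite lee_fin mulr_ge0 ?composed_levy_ge0 ?exprn_ge0.
  by apply: eq_eseriesr => n _; rewrite -EFinD -mulrDl subrK expr1n.
rewrite !composed_levy_series// mulr1 composed_log_at1 composed_ln// EFinN.
by rewrite EFinD => <-; rewrite subeK.
Qed.

Lemma composed_exponent_cvg :
  ln (1 + beta * ln ((1 - alpha * expR (- x)) / (1 - alpha))) @[x --> +oo] -->
  ln (1 + A * beta).
Proof.
have e0 : expR (- x) @[x --> +oo] --> (0 : R).
  exact: cvgr_expR.
have a1 : 0 < (1 - alpha)^-1 by rewrite invr_gt0 subr_gt0.
apply: (@cvg_comp _ _ _ _ (@ln R)); last first.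
  by apply: continuous_ln; exact: D0.
rewrite (_ : 1 + A * beta = 1 + beta * ln ((1 - alpha * 0) / (1 - alpha))).
  apply: cvgD; first exact: cvg_cst.
  apply: cvgMr.
  apply: (@cvg_comp _ _ _ _ (@ln R)); last first.
    by apply: continuous_ln; rewrite mulr0 subr0 mul1r.
  apply: cvgMl; apply: cvgB; first exact: cvg_cst.
  exact: cvgMr.
by rewrite mulr0 subr0 mul1r lnV ?posrE ?subr_gt0// mulrC.
Qed.

End composed_exponent.

(** * Laplace transforms of integer-valued variables as power series *)

Section nat_valued_variable.
Context d (Omega : measurableType d) (R : realType) (P : probability Omega R).
Variables (V : Omega -> R).
Hypotheses (mV : measurable_fun setT V) (natV : forall w, V w \is a Num.nat).

Let mVn n : measurable [set w | V w = n%:R].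
Proof. by rewrite -[X in measurable X]setTI; exact: (mV measurableT (measurable_set1 _)). Qed.

Lemma laplace_nat_valued lambda :
  (\int[P]_w (expR (- lambda * V w))%:E =
   \sum_(0 <= n <oo) (fine (P [set w | V w = n%:R]) * expR (- lambda) ^+ n)%:E)%E.
Proof.
have VT : setT = \bigcup_n [set w | V w = n%:R].
  apply/seteqP; split => // w _; have /natrP[n Vn] := natV w.
  by exists n.
have mf : measurable_fun setT (fun w => (expR (- lambda * V w))%:E).
  apply/measurable_EFinP; apply: measurableT_comp => //.
  exact: measurable_funM.
rewrite VT ge0_integral_bigcup -?VT//; last first.
  apply/trivIsetP => i j _ _ ij; apply/seteqP; split => // w [/= -> /eqP].
  by rewrite eqr_nat (negbTE ij).
apply: eq_eseriesr => n _.
rewrite (eq_integral (cst ((expR (- lambda) ^+ n)%:E))); last first.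
  by move=> w; rewrite inE /= => ->; rewrite -expRM_natr.
rewrite integral_cst// muleC EFinM fineK//.
by apply: fin_num_measure.
Qed.

End nat_valued_variable.

(** * Exponent, Lévy measure and law of the subordinated process *)

Theorem theorem2 (d : measure_display) (Omega : measurableType d)
  (R : realType) (P : probability Omega R)
  (alpha beta A : R) (X T Y : R -> Omega -> R) (psiX psiT psiY : R -> R)
  (c : R) (w : nat -> R)
  (halpha0 : 0 < alpha) (halpha1 : alpha < 1)
  (hA : A = - ln (1 - alpha)) (hbeta : 0 < beta)
  (hXlevy : levy_process P X) (hXnat : nat_valued X)
  (hpsiX : forall lambda : R, 0 <= lambda ->
     psiX lambda = ln ((1 - alpha * expR (- lambda)) / (1 - alpha)))
  (hX : bernstein_function P X psiX) (hXoo : value_at_infty psiX A%:E)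
  (hTsub : subordinator P T)
  (hpsiT : forall lambda : R, 0 <= lambda -> psiT lambda = ln (1 + beta * lambda))
  (hT : bernstein_function P T psiT) (hToo : value_at_infty psiT +oo%E)
  (hXT : independent_processes P X T)
  (hY : Y = subordinate X T)
  (hpsiY : forall lambda : R, 0 <= lambda ->
     psiY lambda =
     ln (1 + beta * ln ((1 - alpha * expR (- lambda)) / (1 - alpha))))
  (hc : c = beta / (1 + A * beta))
  (hw : forall n, (1 <= n)%N ->
     w n = \sum_(1 <= k < n.+1)
             (stirling1 n k)%:R * (stirling1 k 1)%:R * c ^+ k) :
  [/\ bernstein_function P Y psiY /\
        value_at_infty psiY (ln (1 + A * beta))%:E,
      levy_measure P Y (fun n => alpha ^+ n / n`!%:R *
        \sum_(1 <= k < n.+1) (stirling1 n k)%:R * (k.-1)`!%:R * c ^+ k),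
      forall (t : R) (n : nat), 0 <= t ->
        P [set omega | Y t omega = n%:R] =
          (alpha ^+ n / n`!%:R * ((1 + A * beta) `^ t)^-1 *
           \sum_(0 <= k < n.+1) (stirling1 n k)%:R * rising t k * c ^+ k)%:E,
      forall (t : R) (n : nat), 0 <= t ->
        P [set omega | Y t omega = n%:R] =
          (alpha ^+ n / n`!%:R * ((1 + A * beta) `^ t)^-1 *
           \sum_(0 <= k < n.+1) t ^+ k * bell w n k)%:E &
      forall k, (1 <= k)%N -> stirling1 k 1 = (k.-1)`!].
Proof.
subst A Y c.
have bnat t n : 0 <= t -> measurable [set omega | subordinate X T t omega = n%:R].
  move=> t0; rewrite -[X in measurable X]setTI.
  exact: (measurable_subordinate hXlevy hTsub t0 measurableT (measurable_set1 _)).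
have natY : nat_valued (subordinate X T).
  by move=> omega t t0; apply: hXnat; exact: (subordinator_ge0 hTsub).
have ratio_ge1 lambda : 0 <= lambda -> 1 <= (1 - alpha * expR (- lambda)) / (1 - alpha).
  move=> l0; rewrite ler_pdivlMr ?subr_gt0// mul1r lerD2l lerN2 ger_pMr//.
  by rewrite -expR0 ler_expR oppr_le0.
have laplaceY t lambda : 0 <= t -> 0 <= lambda ->
    'E_P[fun omega => expR (- lambda * subordinate X T t omega)]%E =
    (expR (- t * psiY lambda))%:E.
  (* Nonnegativity allows the Laplace transform of [T] to be evaluated at psiX(lambda). *)
  move=> t0 l0; have psi0 : 0 <= psiX lambda by rewrite hpsiX// ln_ge0// ratio_ge1.
  rewrite unlock.
  rewrite (ge0_integral_subordinate hXlevy hTsub hXT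
    (f := fun x => (expR (- lambda * x))%:E))//; last first.
    by apply/measurable_EFinP; apply: measurableT_comp => //; exact: measurable_funM.
  case: hX => _ _ LX; case: hT => _ _ LT.
  transitivity ('E_P[fun omega => expR (- psiX lambda * T t omega)])%E.
    rewrite unlock; apply: eq_integral => w' _.
    have := LX (T t w') lambda (subordinator_ge0 hTsub w' t0) l0.
    by rewrite unlock => ->; rewrite !mulNr mulrC.
  by rewrite LT// hpsiT// hpsiY// hpsiX.
have bernY : bernstein_function P (subordinate X T) psiY.
  split => //; first exact: levy_process_subordinate.
  move=> omega t t0; case: hX => _ X0 _; apply: X0.
  exact: (subordinator_ge0 hTsub).
have pmfY t n : 0 <= t ->
    P [set omega | subordinate X T t omega = n%:R] = (composed_pmf alpha beta t n)%:E.
  move=> t0.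
  suff /(congr1 (fun f => f n)) /= <- :
    (fun n => fine (P [set omega | subordinate X T t omega = n%:R])) = composed_pmf alpha beta t.
    by rewrite fineK//; apply: fin_num_measure; exact: bnat.
  apply: (@power_series_inj _ _ _ (fun z =>
      expR (- t * ln (1 + beta * ln ((1 - alpha * z) / (1 - alpha))))))
    => [k|k|z z0 z1|z z0 z1].
  - exact: fine_ge0.
  - exact: composed_pmf_ge0.
  (* The choice lambda = - ln z gives exp(- lambda) = z. *)
  - have l0 : 0 <= - ln z by rewrite oppr_ge0 -ln1 ler_ln ?posrE.
    have := laplaceY t (- ln z) t0 l0.
    rewrite unlock (laplace_nat_valued P (measurable_subordinate hXlevy hTsub t0)
      (fun omega => natY omega t t0)).
    by rewrite hpsiY// !opprK lnK ?posrE.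
  - by apply: composed_pmf_series => //; exact: ltW.
split.
- split => //.
  rewrite /value_at_infty; apply: cvg_EFin; first exact: nearW.
  apply: cvg_trans (composed_exponent_cvg halpha0 halpha1 hbeta).
  apply: near_eq_cvg; near=> x; rewrite /= hpsiY//.
- have PiE n : alpha ^+ n / n`!%:R *
        (\sum_(1 <= k < n.+1) (stirling1 n k)%:R * (k.-1)`!%:R *
           (beta / (1 + - ln (1 - alpha) * beta)) ^+ k) = composed_levy alpha beta n.
    congr (_ * _); rewrite /stirling_transform -(big_mkord xpredT (fun k =>
      (stirling1 n k)%:R * ((stirling1 k 1)%:R * (beta / (1 + - ln (1 - alpha) * beta)) ^+ k))).
    (* The extra term k = 0 contains |s(0,1)| = 0. *)
    rewrite [RHS]big_ltn// stirling10 mul0r mulr0 add0r.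
    apply: eq_big_nat => -[//|k] _ /=.
    by rewrite stirling1_k1 mulrA.
  split => //.
    by move=> n _; rewrite PiE composed_levy_ge0.
  exists psiY => // lambda l0.
  rewrite hpsiY// -composed_levy_khintchine ?expR_ge0//; last first.
    by rewrite -expR0 ler_expR oppr_le0.
  by apply: eq_eseriesr => n _; rewrite PiE expRM_natr.
- move=> t n t0; rewrite pmfY// /composed_pmf; congr (_ * _)%:E.
  by rewrite big_mkord; apply: eq_bigr => k _; rewrite mulrA.
- move=> t n t0; rewrite pmfY// /composed_pmf; congr (_ * _)%:E.
  apply/esym/bell_sum_rising_transform => m.
  rewrite hw// /stirling_transform -(big_mkord xpredT (fun k =>
    (stirling1 m.+1 k)%:R * ((stirling1 k 1)%:R * (beta / (1 + - ln (1 - alpha) * beta)) ^+ k))).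
  rewrite [RHS]big_ltn// stirling10 mul0r mulr0 add0r.
  by apply: eq_big_nat => k _; rewrite mulrA.
- by case=> // k _; rewrite stirling1_k1.
Unshelve. all: by end_near. Qed.
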